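(* Let $\sigma\in(0,1)$ be any fixed constant. Then for every $\varepsilon\in(0,1)$, $$c_\sigma([-\varepsilon,\varepsilon])\le\frac{P_\sigma(0)}{P_\sigma(1)}\,\varepsilon^{2\lambda_\sigma},$$ and $$c_\sigma\!\left(\left[-\varepsilon\sqrt{2\ln\left(r_\sigma\varepsilon^{-2\lambda_\sigma}\right)},\ \varepsilon\sqrt{2\ln\left(r_\sigma\varepsilon^{-2\lambda_\sigma}\right)}\right]\right)\ge2^{-\lambda_\sigma-1}\varepsilon^{2\lambda_\sigma},$$ where $r_\sigma=4\max\{2,\ \mu_1^{\lambda_\sigma}/2\}$.
   Context: $G$-capacity. For real $a$, $a^{+}=\max\{0,a\}$, $a^{-}=(-a)^{+}$, and for $\sigma\in(0,1]$, $G(a)=\frac12(a^{+}-\sigma^{2}a^{-})$. Let $C_{b,lip}(\mathbb{R})$ be the space of bounded Lipschitz functions on $\mathbb{R}$. For $\phi\in C_{b,lip}(\mathbb{R})$ let $u^\phi$ be the unique (bounded) viscosity solution of the $G$-heat equation $\partial_tu-G(\partial^2_{xx}u)=0$ on $[0,+\infty)\times\mathbb{R}$ with $u(0,x)=\phi(x)$, and set $\hat{\mathbb{E}}_\sigma[\phi]:=u^\phi(1,0)$. For $[a,b]\subseteq\mathbb{R}$, $$c_\sigma([a,b]):=\inf\{\hat{\mathbb{E}}_\sigma[\phi]:\ \phi\ge I_{[a,b]},\ \phi\in C_{b,lip}(\mathbb{R})\},$$ where $I_{[a,b]}$ is the indicator function of $[a,b]$. The exponent $\lambda_\sigma$. For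 $\lambda\in(0,\frac12)$ and $x\in\mathbb{R}$, $\varphi_\lambda(x):=\int_0^{+\infty}y^{-2\lambda}\exp\{-\frac{(y-x)^2}{2}\}dy$; primes denote derivatives in $x$. For each $\lambda\in(0,\frac12)$, $x_1^\lambda<0$ denotes the unique negative number with $\varphi_\lambda''(x_1^\lambda)=0$, $z^\lambda>0$ denotes the unique positive number with $\varphi_\lambda''(z^\lambda)+\varphi_\lambda''(-z^\lambda)=0$ (existence and uniqueness hold), and $\sigma_\lambda:=-x_1^\lambda/z^\lambda\in(0,1)$. The map $\lambda\mapsto\sigma_\lambda$ is a continuous strictly increasing bijection from $(0,\frac12)$ onto $(0,1)$; for $\sigma\in(0,1)$, $\lambda_\sigma\in(0,\frac12)$ denotes the unique constant with $\sigma_{\lambda_\sigma}=\sigma$. The function $P_\sigma$. For $\sigma\in(0,1)$, $$P_\sigma(x):=\begin{cases}\mu_1^{\lambda_\sigma}\varphi_{\lambda_\sigma}(x), & x\le x_1^{\lambda_\sigma},\\ \varphi_{\lambda_\sigma}\!\left(\frac{x}{\sigma}\right)+\varphi_{\lambda_\sigma}\!\left(-\frac{x}{\sigma}\right), & x_1^{\lambda_\sigma}<x<-x_1^{\lambda_\sigma},\\ \mu_1^{\lambda_\sigma}\varphi_{\lambda_\sigma}(-x), & x\ge-x_1^{\lambda_\sigma},\end{cases}\qquad \mu_1^{\lambda_\sigma}=\frac{\varphi_{\lambda_\sigma}\!\left(\frac{x_1^{\lambda_\sigma}}{\sigma}\right)+\varphi_{\lambda_\sigma}\!\left(-\frac{x_1^{\lambda_\sigma}}{\sigma}\right)}{\varphi_{\lambda_\sigma}(x_1^{\lambda_\sigma})}>0.$$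 *)

(* Defs.v *)
From HB Require Import structures.
From mathcomp Require Import all_boot all_order all_algebra.
From mathcomp Require Import all_classical all_reals all_analysis.

Set Implicit Arguments.
Unset Strict Implicit.
Unset Printing Implicit Defensive.

Import Order.TTheory GRing.Theory Num.Theory.
Import numFieldNormedType.Exports.

Local Open Scope classical_set_scope.
Local Open Scope ring_scope.

Definition pos_part (R : realType) (a : R) : R := Num.max 0 a.
Definition neg_part (R : realType) (a : R) : R := pos_part (- a).

Definition G_sigma (R : realType) (sigma a : R) : R :=
  2^-1 * (pos_part a - sigma ^+ 2 * neg_part a).

Definition Cb_lip (R : realType) (phi : R -> R) : Prop :=
  [bounded phi x | x in setT] /\ [lipschitz phi x | x in setT].

(* Functions of (t, x) are curried, with time as the first argument. *)
Definition d_t (R : realType) (u : R -> R -> R) (t x : R) : R :=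
  derive1 (u ^~ x) t.
Definition d_xx (R : realType) (u : R -> R -> R) (t x : R) : R :=
  derive1n 2 (u t) x.

(* psi belongs to C^{1,2}(]0, +oo[ x R); the derivability requirements are
   needed because derive1 is total. *)
Definition C12 (R : realType) (psi : R -> R -> R) : Prop :=
  forall t x : R, 0 < t ->
  [/\ derivable (psi ^~ x) t 1, derivable (psi t) x 1
    & derivable (derive1 (psi t)) x 1] /\
  [/\ {for (t, x), continuous (fun p : R * R => psi p.1 p.2)},
      {for (t, x), continuous (fun p : R * R => d_t psi p.1 p.2)},
      {for (t, x), continuous (fun p : R * R => derive1 (psi p.1) p.2)}
    & {for (t, x), continuous (fun p : R * R => d_xx psi p.1 p.2)}].

(* Viscosity sub/supersolutions of d_t u - G(d_xx u) = 0 on ]0, +oo[ x R,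
   with C^{1,2} test functions touching at a local extremum of u - psi. *)
Definition visc_subsol (R : realType) (sigma : R) (u : R -> R -> R) : Prop :=
  forall (psi : R -> R -> R) (t x : R), C12 psi -> 0 < t ->
  (\forall p \near (t, x), u p.1 p.2 - psi p.1 p.2 <= u t x - psi t x) ->
  d_t psi t x - G_sigma sigma (d_xx psi t x) <= 0.

Definition visc_supersol (R : realType) (sigma : R) (u : R -> R -> R) : Prop :=
  forall (psi : R -> R -> R) (t x : R), C12 psi -> 0 < t ->
  (\forall p \near (t, x), u t x - psi t x <= u p.1 p.2 - psi p.1 p.2) ->
  0 <= d_t psi t x - G_sigma sigma (d_xx psi t x).

(* u is a bounded viscosity solution of the Cauchy problem for the G-heat
   equation on [0, +oo[ x R with initial datum phi; the values of u at
   negative times are irrelevant. *)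
Definition G_heat_sol (R : realType) (sigma : R) (phi : R -> R)
    (u : R -> R -> R) : Prop :=
  [/\ {within [set p : R * R | 0 <= p.1],
         continuous (fun p : R * R => u p.1 p.2)},
      [bounded u p.1 p.2 | p in [set p : R * R | 0 <= p.1]],
      forall x, u 0 x = phi x,
      visc_subsol sigma u
    & visc_supersol sigma u].

(* "v is the G-expectation of phi": as the bounded viscosity solution u^phi
   exists and is unique, this is the graph of phi |-> u^phi(1, 0). *)
Definition is_Gexp (R : realType) (sigma : R) (phi : R -> R) (v : R) : Prop :=
  exists2 u : R -> R -> R, G_heat_sol sigma phi u & v = u 1 0.

(* The infimum is taken in \bar R, so that no convention for the infimum of an
   empty or unbounded set of reals interferes. *)
Definition Gcap (R : realType) (sigma a b : R) : \bar R :=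
  ereal_inf [set e : \bar R | exists (phi : R -> R) (v : R),
    [/\ Cb_lip phi,
        forall x, \1_(`[a, b]%classic) x <= phi x,
        is_Gexp sigma phi v
      & e = v%:E]].

Definition phi_ (R : realType) (lam x : R) : R :=
  \int[lebesgue_measure]_(y in `]0%R, +oo[%classic)
    (y `^ (- (2 * lam)) * expR (- ((y - x) ^+ 2 / 2))).

Definition x1_ (R : realType) (lam : R) : R :=
  [get x : R | x < 0 /\ derive1n 2 (phi_ lam) x = 0].

Definition z_ (R : realType) (lam : R) : R :=
  [get z : R | 0 < z /\ derive1n 2 (phi_ lam) z + derive1n 2 (phi_ lam) (- z) = 0].

Definition sigma_ (R : realType) (lam : R) : R := - x1_ lam / z_ lam.

(* "lam is lambda_sigma", the inverse image of sigma under the bijection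
   lam |-> sigma_ lam from ]0, 1/2[ onto ]0, 1[. *)
Definition is_lambda (R : realType) (sigma lam : R) : Prop :=
  [/\ 0 < lam, lam < 2^-1 & sigma_ lam = sigma].

(* The functions below are meant for lam = lambda_sigma. *)
Definition mu1 (R : realType) (sigma lam : R) : R :=
  (phi_ lam (x1_ lam / sigma) + phi_ lam (- (x1_ lam / sigma)))
    / phi_ lam (x1_ lam).

Definition P_sigma (R : realType) (sigma lam x : R) : R :=
  if x <= x1_ lam then mu1 sigma lam * phi_ lam x
  else if x < - x1_ lam then phi_ lam (x / sigma) + phi_ lam (- (x / sigma))
  else mu1 sigma lam * phi_ lam (- x).

Definition r_ (R : realType) (sigma lam : R) : R :=
  4 * Num.max 2 (mu1 sigma lam / 2).

(* Main.v *)
Require Import Defs.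
From mathcomp Require Import all_boot all_order all_algebra.
From mathcomp Require Import all_classical all_reals all_analysis.
From mathcomp Require Import measurable_realfun ring lra.
Set Implicit Arguments.
Unset Strict Implicit.
Unset Printing Implicit Defensive.
Import Order.TTheory GRing.Theory Num.Theory.
Import numFieldNormedType.Exports.
Local Open Scope classical_set_scope.
Local Open Scope ring_scope.

(* The profile [P] is a C^2 solution of [2 G (P'') + x P' + 2 lam P = 0], so
   [(t + eps^2)^-lam * P (x / sqrt (t + eps^2))] solves the G-heat equation
   classically, hence in the viscosity sense. The equation for [phi_] follows
   from integrating the derivative of [y ^ (1 - 2 lam) exp (- (y - x)^2 / 2)],
   the constant [sigma_] makes both pieces of [P] have a vanishing second
   derivative at the junctions, and the signs of [P''] and [P'] come from the
   monotonicity of [exp (x^2 / 2)] times a derivative of [phi_].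

   Upper bound: starting from [P (x / eps) / P 1], which dominates the indicator
   since [P] decreases in [|x|], the solution at [(1, 0)] is at most
   [P 0 / P 1 * eps ^ (2 lam)].

   Lower bound: for the given radius, [P (x / eps) / P 0] minus its value at the
   radius lies below every admissible datum. Comparison of the corresponding
   smooth solution with the viscosity solution, together with the Gaussian decay
   of [P], gives the bound. *)

(** * Pointwise rules for derivatives *)

(** [Gcap] is an infimum over data and [is_Gexp] is existential over solutions, so the upper bound
    only has to exhibit one datum with one solution, whereas the lower bound must face every
    viscosity solution of every admissible datum. In that comparison one of the two functions is
    C^{1,2}: after a quadratic perturbation it is itself a test function, and the definition of a
    supersolution applies to it directly.

    The analytic obstacle is the integrand of [phi_], singular at 0 and on an unbounded range.
    Pulling exp(-x^2/2) out of the integral leaves moments whose derivative in x is a shift of the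
    index; one integration by parts relates the first three, and the equation, positivity and decay
    of [phi_] are read off from them.

    The time shift eps^2 puts the initial profile on the scale eps and keeps the amplitude factor (1
    + eps^2)^-lam at time 1 between 2^-lam and 1. The factor 4 in [r_] makes the subtracted height
    at most a quarter of eps^(2 lam), hence at most half of 2^-lam eps^(2 lam); this is the extra
    1/2 in 2^(-lam - 1). *)

Section pointwise_derivatives.
Context {R : realType}.
Implicit Types (f g : R -> R) (x a b : R).

(** This and the next rules have explicit function bodies, the shape on which [is_derive_tac]
    matches. *)
Lemma is_derive_addf f g x a b : is_derive x 1 f a -> is_derive x 1 g b ->
  is_derive x 1 (fun y => f y + g y) (a + b).
Proof. exact: is_deriveD. Qed.

Lemma is_derive_oppf f x a : is_derive x 1 f a ->
  is_derive x 1 (fun y => - f y) (- a).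
Proof. exact: is_deriveN. Qed.

Lemma is_derive_mulf f g x a b : is_derive x 1 f a -> is_derive x 1 g b ->
  is_derive x 1 (fun y => f y * g y) (a * g x + f x * b).
Proof.
move=> da db; apply: (is_derive_eq (is_deriveM da db)).
by rewrite /GRing.scale/= addrC [g x * a]mulrC.
Qed.

Lemma is_derive_exprf f n x a : is_derive x 1 f a ->
  is_derive x 1 (fun y => f y ^+ n) (n%:R * f x ^+ n.-1 * a).
Proof. by have := @is_deriveX _ _ f n x 1 a; rewrite exprfctE. Qed.

Lemma is_derive_invf f x a : f x != 0 -> is_derive x 1 f a ->
  is_derive x 1 (fun y => (f y)^-1) (- (f x) ^- 2 * a).
Proof. exact: is_deriveV. Qed.

Lemma is_derive_compf f g x a b : is_derive (g x) 1 f a ->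
  is_derive x 1 g b -> is_derive x 1 (fun y => f (g y)) (a * b).
Proof. exact: is_derive1_comp. Qed.

Lemma is_derive_expRf f x a : is_derive x 1 f a ->
  is_derive x 1 (fun y => expR (f y)) (expR (f x) * a).
Proof. exact: is_derive1_comp. Qed.

Lemma is_derive_cstf (c : R) x : is_derive x 1 (fun=> c) (0 : R).
Proof. exact: is_derive_cst. Qed.

Lemma is_derive_idf x : is_derive x 1 (fun y : R => y) (1 : R).
Proof. exact: is_derive_id. Qed.

Lemma is_derive_continuous f x a : is_derive x 1 f a -> {for x, continuous f}.
Proof.
by case=> df _; apply: differentiable_continuous; apply/derivable1_diffP.
Qed.

Lemma is_derive_derive1 f x a : is_derive x 1 f a -> derive1 f x = a.
Proof. by move=> df; rewrite derive1E derive_val. Qed.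

Lemma is_derive_derivable f x a : is_derive x 1 f a -> derivable f x 1.
Proof. by case. Qed.

End pointwise_derivatives.

(* [notypeclasses refine] prevents instance resolution from closing the premises
   with derivatives of another shape. *)
Ltac is_derive_tac :=
  repeat match goal with
  | |- is_derive _ _ (fun y => ?c) _ => exact: is_derive_cstf
  | |- is_derive _ _ (fun y => y) _ => exact: is_derive_idf
  | H : forall x, is_derive x _ ?f _ |- is_derive _ _ ?f _ => exact: H
  | H : forall x, is_derive x _ ?f _ |- is_derive _ _ (fun y => ?f y) _ =>
      exact: H
  | H : is_derive ?x _ ?f _ |- is_derive ?x _ ?f _ => exact: H
  | |- is_derive _ _ (GRing.mul ?c) _ => notypeclasses refine
      (@is_derive_mulf _ (fun=> c) (fun y => y) _ _ _ _ _)
  | |- is_derive _ _ (GRing.add ?c) _ => notypeclasses refine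
      (@is_derive_addf _ (fun=> c) (fun y => y) _ _ _ _ _)
  | |- is_derive _ _ (fun y => _ + _) _ =>
      notypeclasses refine (@is_derive_addf _ _ _ _ _ _ _ _)
  | |- is_derive _ _ (fun y => - _) _ =>
      notypeclasses refine (@is_derive_oppf _ _ _ _ _)
  | |- is_derive _ _ (fun y => _ * _) _ =>
      notypeclasses refine (@is_derive_mulf _ _ _ _ _ _ _ _)
  | |- is_derive _ _ (fun y => _ ^+ _) _ =>
      notypeclasses refine (@is_derive_exprf _ _ _ _ _ _)
  | |- is_derive _ _ (fun y => expR _) _ =>
      notypeclasses refine (@is_derive_expRf _ _ _ _ _)
  | |- is_derive _ _ (fun y => _^-1) _ =>
      notypeclasses refine (@is_derive_invf _ _ _ _ _ _)
  end.

Ltac is_derive_auto :=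
  notypeclasses refine (@is_derive_eq _ _ _ _ _ _ _ _ _ _);
    [is_derive_tac | rewrite ?/GRing.scale/=].

(** * The moments defining phi *)

Section improper_integral.
Context {R : realType}.
Implicit Types f F : R -> R.
Notation mu := (@lebesgue_measure R).

Lemma itv0y_bigcup :
  `]0%R, +oo[%classic = \bigcup_n `[n.+1%:R^-1 : R, +oo[%classic.
Proof.
apply/seteqP; split=> x /=.
  rewrite in_itv/= andbT => x0; exists (Num.truncn x^-1) => //=.
  by rewrite in_itv/= andbT invf_ple ?posrE// ltW// truncnS_gt.
move=> [n _] /=; rewrite !in_itv/= !andbT; apply: lt_le_trans.
by rewrite invr_gt0.
Qed.

(** Since [f] may be singular at 0, the fundamental theorem is applied on the closed half-lines
    starting at 1/(n+1), and monotone convergence passes to the union; only a right limit of [F] at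
    0 is then involved. *)
Lemma ge0_FTC_itv0y f F (l0 l : R) :
  (forall x : R, 0 < x -> 0 <= f x) ->
  (forall x : R, 0 < x -> {for x, continuous f}) ->
  (forall x : R, 0 < x -> is_derive x 1 F (f x)) ->
  F x @[x --> 0^'+] --> l0 -> F x @[x --> +oo] --> l ->
  (\int[mu]_(x in `]0%R, +oo[) (f x)%:E = (l - l0)%:E)%E.
Proof.
move=> f0 cf dF F0 Fy.
have mf : measurable_fun (`]0%R, +oo[ : set R) f.
  apply: open_continuous_measurable_fun => //.
  by move=> x; rewrite inE/= in_itv/= andbT; exact: cf.
have sub (n : nat) : `[n.+1%:R^-1 : R, +oo[ `<=` `]0%R : R, +oo[.
  move=> x /=; rewrite !in_itv/= !andbT; apply: lt_le_trans.
  by rewrite invr_gt0.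
have intn (n : nat) : (\int[mu]_(x in `[(n.+1%:R^-1)%R, +oo[) (f x)%:E =
    (l - F n.+1%:R^-1)%:E)%E.
  have n0 : 0 < n.+1%:R^-1 :> R by rewrite invr_gt0.
  rewrite EFinB; apply: ge0_continuous_FTC2y => //.
  - by move=> x nx; apply: f0; exact: lt_le_trans nx.
  - apply: continuous_in_subspaceT => x; rewrite inE/= in_itv/= andbT => nx.
    by apply: cf; exact: lt_le_trans nx.
  - by move=> x nx; have := dF x (lt_trans n0 nx); case.
  - apply: cvg_at_right_filter; apply: differentiable_continuous.
    by apply/derivable1_diffP; case: (dF _ n0).
  - move=> x; rewrite in_itv/= andbT => nx; rewrite derive1E.
    by have := dF x (lt_trans n0 nx) => ?; rewrite derive_val.
have cvI : (\int[mu]_(x in `[(n.+1%:R^-1)%R, +oo[) (f x)%:E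
    @[n --> \oo] --> \int[mu]_(x in `]0%R, +oo[) (f x)%:E)%E.
  rewrite itv0y_bigcup; apply: ge0_nondecreasing_set_cvg_integral => //.
  - apply/nondecreasing_seqP => n; apply/subsetPset => x /=.
    rewrite !in_itv/= !andbT; apply: le_trans.
    by rewrite lef_pV2 ?posrE// ler_nat.
  - by move=> n; apply/measurable_EFinP; exact: measurable_funS mf.
  - by move=> n x /sub /=; rewrite in_itv/= andbT lee_fin; exact: f0.
rewrite -(cvg_lim _ cvI)//; apply/cvg_lim => //; rewrite (eq_cvg _ _ intn).
apply: cvg_EFin; first exact: nearW.
apply: cvgB; first exact: cvg_cst.
have /cvg_at_rightP := F0; apply; split; first by move=> n; rewrite invr_gt0.
exact: cvg_harmonic.
Qed.

End improper_integral.

Section moments.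
Context {R : realType}.
Notation mu := (@lebesgue_measure R).
Variable lam : R.
Hypotheses (lam_gt0 : 0 < lam) (lam_lt : lam < 2^-1).

(** For [k = 0] this is the integrand of [phi_] without the factor exp(-x^2/2), which depends on x
    alone. What remains depends on x through exp(x y), so that differentiating in x raises [k] by
    one. *)
Definition moment_kernel (k : nat) (x y : R) : R :=
  y ^+ k * (y `^ (- (2 * lam)) * expR (x * y - y ^+ 2 / 2)).

Definition moment (k : nat) (x : R) : R :=
  \int[lebesgue_measure]_(y in `]0%R, +oo[) moment_kernel k x y.

Let p : R := 1 - 2 * lam.
Let p_gt0 : 0 < p. Proof. rewrite /p; move: lam_lt; lra. Qed.

Lemma continuous_at_powR (a y : R) : 0 < y ->
  {for y, continuous (fun y : R => y `^ a)}.
Proof.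
by move=> y0; apply: is_derive_continuous (is_derive1_powR a y0).
Qed.

(* An integrable majorant of all the kernels up to a constant, chosen for its
   explicit primitive. *)
Definition dominator (y : R) : R :=
  p * (y / (1 + y)) `^ (p - 1) * (1 + y) ^- 2.

Definition dominator_prim (y : R) : R := (y / (1 + y)) `^ p.

Let divD1_gt0 (y : R) : 0 < y -> 0 < y / (1 + y).
Proof. by move=> y0; rewrite divr_gt0// addr_gt0. Qed.

Lemma is_derive_divD1 (y : R) : 0 < y ->
  is_derive y 1 (fun y => y / (1 + y)) ((1 + y) ^- 2).
Proof.
move=> y0; have y1 : 1 + y != 0 by rewrite gt_eqF// addr_gt0.
by is_derive_auto; last field.
Qed.

Lemma is_derive_dominator (y : R) : 0 < y ->
  is_derive y 1 dominator_prim (dominator y).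
Proof.
move=> y0.
have := @is_derive1_comp _ (fun y : R => y `^ p) (fun y => y / (1 + y)) y _ _
  (is_derive1_powR p (divD1_gt0 y0)) (is_derive_divD1 y0).
by [].
Qed.

Lemma dominator_ge0 y : 0 <= dominator y.
Proof.
rewrite /dominator mulr_ge0//.
  by rewrite mulr_ge0// ?powR_ge0// ltW.
by rewrite invr_ge0 sqr_ge0.
Qed.

Let continuous_divD1 (y : R) : 0 < y ->
  {for y, continuous (fun y : R => y / (1 + y))}.
Proof.
by move=> y0; apply: is_derive_continuous (is_derive_divD1 y0).
Qed.

Lemma continuous_dominator (y : R) : 0 < y -> {for y, continuous dominator}.
Proof.
move=> y0; apply: cvgM; last first.
  apply: cvgV; first by rewrite gt_eqF// exprn_gt0// addr_gt0.
  apply: (@continuous_comp _ _ _ (fun y : R => 1 + y) (fun y => y ^+ 2)).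
    by apply: cvgD; [exact: cvg_cst|exact: cvg_id].
  exact: exprn_continuous.
apply: cvgM; first exact: cvg_cst.
apply: (@continuous_comp _ _ _ (fun y : R => y / (1 + y))
  (fun y : R => y `^ (p - 1))).
  exact: continuous_divD1.
by apply: continuous_at_powR; exact: divD1_gt0.
Qed.

Lemma dominator_prim_cvg0 : dominator_prim y @[y --> 0^'+] --> 0.
Proof.
apply: (@squeeze_cvgr _ _ _ _ (cst 0) (fun y : R => y `^ p)); last 2 first.
- exact: cvg_cst.
- exact: powR_cvg0.
near=> y.
have y0 : 0 < y by near: y; exact: nbhs_right_gt.
rewrite powR_ge0/= ge0_ler_powR ?ltW// ?nnegrE ?ltW//.
  exact: divD1_gt0.
by rewrite ltr_pdivrMr ?addr_gt0// mulrDr mulr1 ltrDl mulr_gt0.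
Unshelve. all: by end_near. Qed.

Lemma dominator_prim_cvgy : dominator_prim y @[y --> +oo] --> (1 : R).
Proof.
have h : (y / (1 + y)) @[y --> +oo] --> (1 : R).
  have : (1 - (1 + y)^-1) @[y --> +oo] --> (1 - 0 : R).
    apply: cvgB; first exact: cvg_cst.
    apply/(@gtr0_cvgV0 _ _ _ _ (fun y : R => 1 + y)).
      by near=> y; rewrite addr_gt0//; near: y; exact: nbhs_pinfty_gt.
    apply/cvgryPge => A; near=> y.
    by rewrite -lerBlDl; near: y; apply: nbhs_pinfty_ge; exact: num_real.
  rewrite subr0; apply: cvg_trans; apply: near_eq_cvg; near=> y.
  have y0 : 0 < y by near: y; apply: nbhs_pinfty_gt; exact: num_real.
  by field; rewrite gt_eqF// addr_gt0.
have := @continuous_at_powR p 1 ltr01; rewrite /prop_for /continuous_at powR1.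
exact: cvg_comp.
Unshelve. all: by end_near. Qed.

Lemma FTC_dominator : (\int[mu]_(y in `]0%R, +oo[) (dominator y)%:E = 1%:E)%E.
Proof.
rewrite -[X in X%:E]subr0.
apply: (ge0_FTC_itv0y _ continuous_dominator is_derive_dominator).
- by move=> y _; exact: dominator_ge0.
- exact: dominator_prim_cvg0.
- exact: dominator_prim_cvgy.
Qed.

Lemma measurable_itv0y (f : R -> R) :
  (forall y : R, 0 < y -> {for y, continuous f}) ->
  measurable_fun (`]0%R, +oo[ : set R) f.
Proof.
move=> cf; apply: open_continuous_measurable_fun => //.
by move=> x; rewrite inE/= in_itv/= andbT; exact: cf.
Qed.

Lemma integrable_dominator :
  mu.-integrable `]0%R, +oo[ (EFin \o dominator).
Proof.
apply/integrableP; split.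
  by apply/measurable_EFinP; exact: measurable_itv0y continuous_dominator.
under eq_integral => y _ do rewrite /= ger0_norm ?dominator_ge0//.
by rewrite FTC_dominator ltry.
Qed.

(** Completing the square: the exponents differ by (c + 1 - y)^2 / 2. *)
Lemma expR_linB_sqr_le (c y : R) :
  expR (c * y - y ^+ 2 / 2) <= expR ((c + 1) ^+ 2 / 2) * expR (- y).
Proof.
rewrite -expRD ler_expR -subr_ge0.
have -> : (c + 1) ^+ 2 / 2 - y - (c * y - y ^+ 2 / 2) = (c + 1 - y) ^+ 2 / 2.
  by field.
by rewrite divr_ge0// sqr_ge0.
Qed.

(** In the shift of x, [k] accounts for y^k <= exp(k y), and each unit of the 2 buys one factor
    exp(-y) <= (1 + y)^-1. Dividing by [p] cancels the factor [p] of [dominator]. *)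
Definition dominator_cst (k : nat) (x : R) : R :=
  expR ((x + k%:R + 2) ^+ 2 / 2) / p.

Lemma moment_kernel_gt0 k x y : 0 < y -> 0 < moment_kernel k x y.
Proof.
move=> y0; apply: mulr_gt0; first exact: exprn_gt0.
by rewrite mulr_gt0 ?expR_gt0 ?powR_gt0.
Qed.

Lemma moment_kernel_ge0 k x y : 0 < y -> 0 <= moment_kernel k x y.
Proof. by move=> y0; apply/ltW/moment_kernel_gt0. Qed.

Lemma moment_kernel_le k x b y : 0 < y -> x <= b ->
  moment_kernel k x y <= moment_kernel k b y.
Proof.
move=> y0 xb; apply: ler_wpM2l; first by rewrite exprn_ge0// ltW.
apply: ler_wpM2l; first exact: powR_ge0.
by rewrite ler_expR lerD2r ler_wpM2r// ltW.
Qed.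

Lemma moment_kernel_le_dominator k x y : 0 < y ->
  moment_kernel k x y <= dominator_cst k x * dominator y.
Proof.
move=> y0; have y1 : 0 < 1 + y by rewrite addr_gt0.
have le1 : y ^+ k * expR (x * y - y ^+ 2 / 2) <=
    expR ((x + k%:R + 2) ^+ 2 / 2) * (1 + y) ^- 2.
  have -> : (x + k%:R + 2) = (x + k%:R + 1) + 1 by ring.
  apply: (@le_trans _ _ (expR ((x + k%:R + 1) * y - y ^+ 2 / 2) * expR (- y))).
    apply: (@le_trans _ _ (expR (k%:R * y) * expR (x * y - y ^+ 2 / 2))).
      rewrite ler_wpM2r ?expR_ge0// expRM_natl.
      rewrite lerXn2r ?nnegrE ?expR_ge0 ?(ltW y0) ?(ltW y1)//.
      by apply: le_trans (expR_ge1Dx y); rewrite lerDr.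
    by rewrite -!expRD ler_expR; lra.
  apply: (le_trans (ler_wpM2r (expR_ge0 _) (expR_linB_sqr_le _ _))).
  rewrite -mulrA ler_wpM2l ?expR_ge0// -expr2 expRN exprVn.
  rewrite lef_pV2 ?posrE ?exprn_gt0 ?expR_gt0//.
  rewrite lerXn2r ?nnegrE ?expR_ge0 ?(ltW y0) ?(ltW y1)//.
  exact: expR_ge1Dx.
(* The exponent is negative and y/(1+y) <= y. *)
have le2 : y `^ (- (2 * lam)) <= (y / (1 + y)) `^ (p - 1).
  have -> : p - 1 = - (2 * lam) by rewrite /p; ring.
  rewrite !powRN lef_pV2 ?posrE ?powR_gt0//; last exact: divD1_gt0.
  rewrite ge0_ler_powR ?nnegrE ?(ltW y0) ?(ltW (divD1_gt0 y0))//.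
    by rewrite mulr_ge0// ltW.
  by rewrite ler_pdivrMr// mulrDr mulr1 lerDl mulr_ge0// ltW.
rewrite /moment_kernel /dominator_cst /dominator.
have -> : expR ((x + k%:R + 2) ^+ 2 / 2) / p *
    (p * (y / (1 + y)) `^ (p - 1) * (1 + y) ^- 2) =
    (y / (1 + y)) `^ (p - 1) * (expR ((x + k%:R + 2) ^+ 2 / 2) * (1 + y) ^- 2).
  by field; rewrite gt_eqF//= gt_eqF.
rewrite mulrCA; apply: ler_pM => //; first exact: powR_ge0.
by rewrite mulr_ge0 ?expR_ge0// exprn_ge0// ltW.
Qed.

Lemma is_derive_expR_exponent (x y : R) :
  is_derive y 1 (fun y => expR (x * y - y ^+ 2 / 2))
    (expR (x * y - y ^+ 2 / 2) * (x - y)).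
Proof. by is_derive_auto; field. Qed.

Lemma continuous_moment_kernel k x (y : R) : 0 < y ->
  {for y, continuous (moment_kernel k x)}.
Proof.
move=> y0; apply: cvgM; first exact: exprn_continuous.
apply: cvgM; first exact: continuous_at_powR.
exact: is_derive_continuous (is_derive_expR_exponent x y).
Qed.

Lemma integrable_moment_kernel k x :
  mu.-integrable `]0%R, +oo[ (EFin \o moment_kernel k x).
Proof.
have ig : mu.-integrable `]0%R, +oo[
    (fun y => (dominator_cst k x)%:E * (dominator y)%:E)%E.
  by apply: integrableZl => //; exact: integrable_dominator.
apply: le_integrable ig => //.
  apply/measurable_EFinP; apply: measurable_itv0y => y.
  exact: continuous_moment_kernel.
move=> y /=; rewrite in_itv/= andbT => y0.
rewrite lee_fin ger0_norm ?moment_kernel_ge0//.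
by apply: le_trans (ler_norm _); exact: moment_kernel_le_dominator.
Qed.

End moments.

Section moment_recursion.
Context {R : realType}.
Notation mu := (@lebesgue_measure R).
Variable lam : R.
Hypotheses (lam_gt0 : 0 < lam) (lam_lt : lam < 2^-1).

Let is_derive_moment_kernel k (x y : R) :
  is_derive x 1 (fun x => moment_kernel lam k x y) (moment_kernel lam k.+1 x y).
Proof.
by rewrite /moment_kernel; is_derive_auto; rewrite [y ^+ k.+1]exprS; field.
Qed.

(** Differentiation under the integral sign on the window ]x - 1, x + 1[. The kernels increase with
    x, so the bound of the kernel of index k+1 at x + 1 serves the whole window. *)
Lemma is_derive_moment k (x : R) :
  is_derive x 1 (moment lam k) (moment lam k.+1 x).
Proof.
pose G (y : R) := dominator_cst lam k.+1 (x + 1) * dominator lam y.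
have G_ge0 (y : R) : 0 <= G y.
  apply: mulr_ge0; last exact: dominator_ge0.
  by apply: divr_ge0; [exact: expR_ge0|move: lam_lt; lra].
have Ix : (`]x - 1, x + 1[%classic : set R) x.
  by rewrite /= in_itv/= ltrDl ltr01 ltrBlDr ltrDl ltr01.
have dE (y z : R) : partial1of2 (moment_kernel lam k) z y =
    moment_kernel lam k.+1 z y.
  exact: is_derive_derive1.
have intG : mu.-integrable `]0%R, +oo[ (EFin \o G).
  rewrite (_ : _ \o _ = fun y =>
    ((dominator_cst lam k.+1 (x + 1))%:E * (dominator lam y)%:E)%E)//.
  by apply: integrableZl => //; exact: integrable_dominator.
have intf (z : R) : mu.-integrable `]0%R, +oo[ (EFin \o moment_kernel lam k z).
  exact: integrable_moment_kernel.
have intE : \int[mu]_(y in `]0%R, +oo[) partial1of2 (moment_kernel lam k) x y =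
    moment lam k.+1 x.
  by apply: eq_Rintegral => y _; exact: dE.
have cvgM : h^-1 *: (moment lam k (h + x) - moment lam k x) @[h --> 0^'] -->
    moment lam k.+1 x.
  rewrite -intE.
  apply: (@cvg_differentiation_under_integral R _ _ mu (moment_kernel lam k)
    `]0%R, +oo[%classic _ x (x - 1) (x + 1) Ix (fun z _ => intf z) _ G
    G_ge0 intG) => //.
  move=> z y /=; rewrite !in_itv/= andbT => /andP[_ zx] y0.
  rewrite dE ger0_norm; last exact: moment_kernel_ge0.
  apply: (le_trans (moment_kernel_le _ _ y0 (ltW zx))).
  exact: moment_kernel_le_dominator.
apply: DeriveDef; last first.
  by rewrite -derive1E; apply: cvg_lim.
apply/cvg_ex; exists (moment lam k.+1 x) => /=.
by under eq_fun do rewrite scaler1.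
Qed.

Let q : R := 1 - 2 * lam.
Let q_gt0 : 0 < q. Proof. by rewrite /q; move: lam_lt; lra. Qed.

Let prim (x y : R) : R := y `^ q * expR (x * y - y ^+ 2 / 2).

Let dprim (x y : R) : R := q * moment_kernel lam 0 x y +
  x * moment_kernel lam 1 x y - moment_kernel lam 2 x y.

Let is_derive_prim (x y : R) : 0 < y -> is_derive y 1 (prim x) (dprim x y).
Proof.
move=> y0.
have dp := is_derive1_powR q y0.
apply: (is_derive_eq (is_derive_mulf dp (is_derive_expR_exponent x y))).
have -> : y `^ q = y * y `^ (- (2 * lam)).
  by rewrite /q powRD ?gt_eqF ?implybT// powRr1// ltW.
have -> : q - 1 = - (2 * lam) by rewrite /q; ring.
by rewrite /dprim /moment_kernel expr0 expr1; field.
Qed.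

Let prim_cvg0 (x : R) : prim x y @[y --> 0^'+] --> 0.
Proof.
rewrite -[0 in X in _ --> X](mul0r (expR (x * 0 - 0 ^+ 2 / 2))).
apply: cvgM; first exact: powR_cvg0.
apply: cvg_at_right_filter.
exact: is_derive_continuous (is_derive_expR_exponent x 0).
Qed.

Let prim_cvgy (x : R) : prim x y @[y --> +oo] --> 0.
Proof.
pose K := expR ((x + 1 + 1) ^+ 2 / 2).
apply: (@squeeze_cvgr _ _ _ _ (cst 0) (fun y => K * expR (- y))); last 2 first.
- exact: cvg_cst.
- rewrite -[0 in X in _ --> X](mulr0 K).
  by apply: cvgM; [exact: cvg_cst|exact: cvgr_expR].
near=> y.
have y1 : 1 <= y by near: y; apply: nbhs_pinfty_ge; exact: num_real.
have y0 : 0 < y by apply: lt_le_trans y1.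
rewrite /= mulr_ge0 ?powR_ge0 ?expR_ge0//=.
apply: (@le_trans _ _ (expR ((x + 1) * y - y ^+ 2 / 2))).
  have -> : (x + 1) * y - y ^+ 2 / 2 = y + (x * y - y ^+ 2 / 2) by ring.
  rewrite expRD ler_wpM2r ?expR_ge0//.
  apply: (@le_trans _ _ y).
    by rewrite ler1_powR// /q; move: lam_gt0; lra.
  by apply: le_trans (expR_ge1Dx y); rewrite lerDr.
exact: expR_linB_sqr_le.
Unshelve. all: by end_near. Qed.

(* Integrates the derivative of [y ^ (1 - 2 lam) * exp (x y - y ^ 2 / 2)]; the
   dominator is added to reduce to the integral of a nonnegative function. *)
Lemma moment2E (x : R) :
  moment lam 2 x = x * moment lam 1 x + (1 - 2 * lam) * moment lam 0 x.
Proof.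
pose C (k : nat) : R := dominator_cst lam k x.
have C0 k : 0 <= C k.
  by apply: divr_ge0; [exact: expR_ge0|exact: ltW q_gt0].
pose B := q * C 0%N + `|x| * C 1%N + C 2%N.
have kle k y : 0 < y -> moment_kernel lam k x y <= C k * dominator lam y.
  by move=> y0; exact: moment_kernel_le_dominator.
have ik k : mu.-integrable `]0%R, +oo[ (EFin \o moment_kernel lam k x).
  exact: integrable_moment_kernel.
have ig : mu.-integrable `]0%R, +oo[ (EFin \o dominator lam).
  exact: integrable_dominator.
have sum_ge0 (y : R) : 0 < y -> 0 <= B * dominator lam y + dprim x y.
  move=> y0; 
  have k1 : `|x| * moment_kernel lam 1 x y <= `|x| * (C 1%N * dominator lam y).
    by apply: ler_wpM2l => //; exact: kle.
  have k2 := kle 2%N _ y0; rewrite /dprim /B.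
  have qk0 : 0 <= q * moment_kernel lam 0 x y.
    by apply: mulr_ge0; [exact: ltW|exact: moment_kernel_ge0].
  have qC0 : 0 <= q * C 0%N * dominator lam y.
    by apply: mulr_ge0; [apply: mulr_ge0; [exact: ltW|]|exact: dominator_ge0].
  have xk : - (`|x| * moment_kernel lam 1 x y) <= x * moment_kernel lam 1 x y.
    rewrite -mulNr; apply: ler_wpM2r; first exact: moment_kernel_ge0.
    by rewrite lerNl -normrN ler_norm.
  lra.
have dsum (y : R) : 0 < y -> is_derive y 1
    (fun y => B * dominator_prim lam y + prim x y)
    (B * dominator lam y + dprim x y).
  move=> y0; have d1 := is_derive_dominator lam y0.
  have d2 := is_derive_prim x y0.
  by is_derive_auto; ring.
have csum (y : R) : 0 < y ->
    {for y, continuous (fun y : R => B * dominator lam y + dprim x y)}.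
  move=> y0; apply: cvgD.
    by apply: cvgM; [exact: cvg_cst|exact: continuous_dominator].
  apply: cvgB; last exact: continuous_moment_kernel.
  apply: cvgD.
    by apply: cvgM; [exact: cvg_cst|exact: continuous_moment_kernel].
  by apply: cvgM; [exact: cvg_cst|exact: continuous_moment_kernel].
have := ge0_FTC_itv0y sum_ge0 csum dsum (l0 := B * 0 + 0) (l := B * 1 + 0).
rewrite !mulr0 mulr1 !addr0 subr0 => intE.
(* The primitive of the sum runs from 0 to [B], which is also the integral of [B * dominator lam];
   hence [dprim x] integrates to 0. *)
have {}intE : \int[mu]_(y in `]0%R, +oo[) (B * dominator lam y + dprim x y) = B.
  rewrite /Rintegral intE//.
    rewrite -[0 in X in _ --> X](addr0 (0 : R)).
    apply: cvgD; last exact: prim_cvg0.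
    rewrite -[0 in X in _ --> X](mulr0 B).
    by apply: cvgM; [exact: cvg_cst|exact: dominator_prim_cvg0].
  rewrite -[B in X in _ --> X](addr0 B).
  apply: cvgD; last exact: prim_cvgy.
  rewrite -[B in X in _ --> X](mulr1 B).
  by apply: cvgM; [exact: cvg_cst|exact: dominator_prim_cvgy].
have iZ (c : R) f : mu.-integrable `]0%R, +oo[ (EFin \o f) ->
    mu.-integrable `]0%R, +oo[ (EFin \o (fun y => c * f y)).
  move=> fi; rewrite (_ : _ \o _ = fun y => (c%:E * (f y)%:E)%E)//.
  exact: integrableZl.
have iD f g : mu.-integrable `]0%R, +oo[ (EFin \o f) ->
    mu.-integrable `]0%R, +oo[ (EFin \o g) ->
    mu.-integrable `]0%R, +oo[ (EFin \o (fun y => f y + g y)).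
  move=> fi gi; rewrite (_ : _ \o _ = fun y => ((f y)%:E + (g y)%:E)%E)//.
  exact: integrableD.
have i01 : mu.-integrable `]0%R, +oo[ (EFin \o (fun y =>
    q * moment_kernel lam 0 x y + x * moment_kernel lam 1 x y)).
  by apply: iD; exact: iZ.
have idprim : mu.-integrable `]0%R, +oo[ (EFin \o dprim x).
  rewrite (_ : dprim x = fun y => q * moment_kernel lam 0 x y +
    x * moment_kernel lam 1 x y + (-1) * moment_kernel lam 2 x y).
    by apply: iD => //; exact: iZ.
  by apply/funext => y; rewrite mulN1r.
move: intE; rewrite RintegralD//; last exact: iZ.
have intg : \int[mu]_(y in `]0%R, +oo[) dominator lam y = 1.
  by rewrite /Rintegral FTC_dominator.
rewrite RintegralZl// intg mulr1.
rewrite RintegralB//.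
rewrite RintegralD//; [|exact: iZ|exact: iZ].
rewrite (@RintegralZl _ _ _ _ _ _ q)// (@RintegralZl _ _ _ _ _ _ x)//.
rewrite -/(moment lam 0 x) -/(moment lam 1 x) -/(moment lam 2 x).
by move=> intE; rewrite -/q; lra.
Qed.

End moment_recursion.

(** * The function phi *)

Section phi.
Context {R : realType}.
Notation mu := (@lebesgue_measure R).
Variable lam : R.
Hypotheses (lam_gt0 : 0 < lam) (lam_lt : lam < 2^-1).

Notation phi := (phi_ lam).

Lemma phiE (x : R) : phi x = expR (- (x ^+ 2 / 2)) * moment lam 0 x.
Proof.
rewrite /phi_ /moment -RintegralZl//; last exact: integrable_moment_kernel.
apply: eq_Rintegral => y _; rewrite /moment_kernel expr0 mul1r mulrCA -expRD.
by congr (_ * expR _); field.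
Qed.

Definition phi_d1 (x : R) : R :=
  expR (- (x ^+ 2 / 2)) * (moment lam 1 x - x * moment lam 0 x).
(** Defined by the differential equation itself; the content of the equation is carried by
    [is_derive_phi1], where the moment recursion enters. *)
Definition phi_d2 (x : R) : R := - (x * phi_d1 x) - 2 * lam * phi x.

Lemma is_derive_phi (x : R) : is_derive x 1 phi (phi_d1 x).
Proof.
rewrite (_ : phi = fun x => expR (- (x ^+ 2 / 2)) * moment lam 0 x); last first.
  by apply/funext => y; exact: phiE.
have d0 := is_derive_moment lam_gt0 lam_lt 0 x.
by is_derive_auto; rewrite /phi_d1; field.
Qed.

Lemma is_derive_phi1 (x : R) : is_derive x 1 phi_d1 (phi_d2 x).
Proof.
have d0 := is_derive_moment lam_gt0 lam_lt 0 x.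
have d1 := is_derive_moment lam_gt0 lam_lt 1 x.
rewrite /phi_d1; is_derive_auto.
by rewrite /phi_d2 /phi_d1 phiE moment2E//; field.
Qed.

Lemma phi2E (x : R) : derive1n 2 phi x = phi_d2 x.
Proof.
rewrite /derive1n/= (_ : derive1 phi = phi_d1).
  exact: is_derive_derive1 (is_derive_phi1 x).
by apply/funext => y; exact: is_derive_derive1 (is_derive_phi y).
Qed.

Lemma is_derive_phi2 (x : R) :
  is_derive x 1 phi_d2 (- (x * phi_d2 x) - (1 + 2 * lam) * phi_d1 x).
Proof.
have d0 := is_derive_phi x; have d1 := is_derive_phi1 x.
by rewrite /phi_d2; is_derive_auto; rewrite /phi_d2; ring.
Qed.

(** On [1, 2] the kernel is at least the constant [c], obtained from y^k >= 1 and the worst cases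
    y^(-2 lam) >= 2^(-2 lam), x y >= -2|x| and y^2 / 2 <= 2. *)
Lemma moment_gt0 k (x : R) : 0 < moment lam k x.
Proof.
have m12 : measurable (`[1%R, 2%R] : set R) by [].
pose c := 2 `^ (- (2 * lam)) * expR (- (`|x| * 2) - 2).
have c0 : 0 < c by rewrite mulr_gt0 ?powR_gt0 ?expR_gt0.
have sub : `[1%R, 2%R] `<=` (`]0%R, +oo[ : set R).
  by move=> y /=; rewrite !in_itv/= andbT => /andP[y1 _]; exact: lt_le_trans y1.
have ik := integrable_moment_kernel lam_gt0 lam_lt k x.
have ik12 : mu.-integrable `[1%R, 2%R] (EFin \o moment_kernel lam k x).
  exact: integrableS ik.
apply: (@lt_le_trans _ _ (\int[mu]_(y in `[1%R, 2%R]) moment_kernel lam k x y)).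
  apply: (@lt_le_trans _ _ (\int[mu]_(y in `[1%R, 2%R]) c)).
    rewrite Rintegral_cst// mulr_gt0//.
    suff h : mu (`[1%R, 2%R] : set R) = 1%:E.
      by rewrite -[ltRHS]/(fine (mu (`[1%R, 2%R] : set R))) h/= ltr01.
    rewrite lebesgue_measure_itv/= lte_fin ltr1n -EFinB; congr EFin; lra.
  apply: le_Rintegral => //.
    apply: continuous_compact_integrable; first exact: segment_compact.
    by apply: continuous_subspaceT => ?; exact: cvg_cst.
  move=> y /=; rewrite in_itv/= => /andP[y1 y2].
  have y0 : 0 < y by exact: lt_le_trans y1.
  rewrite /moment_kernel -[leLHS]mul1r; apply: ler_pM => //.
  - exact: ltW.
  - exact: exprn_ege1.
  apply: ler_pM; [exact: powR_ge0|exact: expR_ge0| |].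
    rewrite !powRN lef_pV2 ?posrE ?powR_gt0//; apply: ge0_ler_powR => //.
    - by rewrite mulr_ge0// ltW.
    - exact: ltW.
    - by rewrite nnegrE.
  rewrite ler_expR; have xy : - (`|x| * 2) <= x * y.
    rewrite -mulNr; apply: (@le_trans _ _ (- `|x| * y)).
      by rewrite !mulNr lerN2 ler_wpM2l.
    by rewrite ler_wpM2r ?(ltW y0)// lerNl -normrN ler_norm.
  by rewrite lerB//; nra.
rewrite /moment /Rintegral fine_le//.
- exact: integrable_fin_num.
- exact: integrable_fin_num.
- apply: ge0_subset_integral => //; first by case/integrableP : ik.
  move=> y /=; rewrite in_itv/= andbT lee_fin; exact: moment_kernel_ge0.
Qed.

Lemma phi_gt0 (x : R) : 0 < phi x.
Proof. by rewrite phiE mulr_gt0 ?expR_gt0 ?moment_gt0. Qed.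

Lemma phi1_gt0 (x : R) : x <= 0 -> 0 < phi_d1 x.
Proof.
move=> x0; rewrite mulr_gt0 ?expR_gt0// ltr_wpDr ?moment_gt0//.
by rewrite -mulNr mulr_ge0 ?oppr_ge0// ltW ?moment_gt0.
Qed.

End phi.

(** * Mean value theorem, local maxima and gluing *)

Section mean_value.
Context {R : realType}.
Implicit Types (f df : R -> R) (a b : R).

Lemma MVT_ex f df a b : a < b -> (forall x : R, is_derive x 1 f (df x)) ->
  exists c, [/\ a < c, c < b & f b - f a = df c * (b - a)].
Proof.
move=> ab fdf; have cf : {within `[a, b], continuous f}.
  by apply: continuous_subspaceT => x; exact: is_derive_continuous (fdf x).
have [c] := @MVT _ f df a b ab (fun x _ => fdf x) cf.
by rewrite in_itv/= => /andP[ac cb] fE; exists c.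
Qed.

Lemma derive_lt0_lt f df a b : a < b ->
  (forall x : R, is_derive x 1 f (df x)) ->
  (forall x, a < x -> x < b -> df x < 0) -> f b < f a.
Proof.
move=> ab fdf df0; have [c [ac cb fE]] := MVT_ex ab fdf.
by rewrite -subr_lt0 fE nmulr_rlt0 ?df0// subr_gt0.
Qed.

Lemma derive_le0_le f df a b : a <= b ->
  (forall x : R, is_derive x 1 f (df x)) ->
  (forall x, a < x -> x < b -> df x <= 0) -> f b <= f a.
Proof.
rewrite le_eqVlt => /predU1P[->//|ab] fdf df0.
have [c [ac cb fE]] := MVT_ex ab fdf.
by rewrite -subr_le0 fE mulr_le0_ge0 ?df0// subr_ge0 ltW.
Qed.

Lemma derive_ge0_le f df a b : a <= b ->
  (forall x : R, is_derive x 1 f (df x)) ->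
  (forall x, a < x -> x < b -> 0 <= df x) -> f a <= f b.
Proof.
move=> ab fdf df0; rewrite -lerN2.
apply: (derive_le0_le ab (fun x => is_derive_oppf (fdf x))) => x ax xb.
by rewrite oppr_le0 df0.
Qed.

Lemma derive_bounded_lipschitz f df (M : R) :
  (forall x : R, is_derive x 1 f (df x)) -> (forall x, `|df x| <= M) ->
  forall x y, `|f x - f y| <= M * `|x - y|.
Proof.
move=> fdf dfM.
have lipM (x y : R) : x < y -> `|f x - f y| <= M * `|x - y|.
  move=> xy; have [z [_ _ E]] := MVT_ex xy fdf.
  by rewrite distrC E normrM (distrC x y) ler_wpM2r.
move=> x y; have [/lipM//|/lipM|->] := ltgtP x y.
  by rewrite distrC (distrC y x).
by rewrite !subrr normr0 mulr0.
Qed.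

End mean_value.

Section local_maximum.
Context {R : realType}.
Implicit Types (f df : R -> R).

Lemma near_itv (P : R -> Prop) (x : R) : (\forall y \near x, P y) ->
  exists2 e, 0 < e & forall y, x - e < y -> y < x + e -> P y.
Proof.
move=> [e /= e0 eP]; exists e => // y xy yx; apply: eP => /=.
by rewrite distrC ltr_distl xy yx.
Qed.

Lemma local_max_derive f (x d : R) :
  (\forall y \near x, derivable f (y : R) 1) -> is_derive x 1 f d ->
  (\forall y \near x, f y <= f x) -> d = 0.
Proof.
move=> fd dfx fx; have [e e0 h] := near_itv (filterI fd fx).
have xe : x \in `](x - e), (x + e)[.
  by rewrite in_itv/= ltrDl e0 ltrBlDr ltrDl e0.
have := @derive1_at_max _ f (x - e) (x + e) x _ _ xe _.
have le_e : x - e <= x + e by rewrite lerBlDr -addrA lerDl; lra.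
move=> /(_ le_e) dx0.
have {}dx0 : is_derive x 1 f 0.
  by apply: dx0 => y; rewrite in_itv/= => /andP[xy yx]; have [] := h y xy yx.
by rewrite -(is_derive_derive1 dfx) (is_derive_derive1 dx0).
Qed.

(** Only derivability of [df] at the point x is available, so the argument uses its Caratheodory
    slope: if d > 0, the slope is positive near x, [df] is positive just to the right of x, and the
    mean value theorem makes f exceed its maximum. *)
Lemma local_max_derive2 f df (x d : R) :
  (forall y : R, is_derive y 1 f (df y)) -> is_derive x 1 df d ->
  (\forall y \near x, f y <= f x) -> d <= 0.
Proof.
move=> fdf dd fx; rewrite leNgt; apply/negP => d0.
have nd : \forall y \near x, derivable f (y : R) 1.
  by near=> y; exact: is_derive_derivable (fdf y).
have dfx0 : df x = 0 := local_max_derive nd (fdf x) fx.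
have [g [gE gc gx]] := (is_derive1_caratheodory _ _ _).1 dd.
have gpos : \forall y \near x, 0 < g y.
  by have /cvgr_gt := gc; apply; rewrite gx.
have [e e0 h] := near_itv (filterI fx gpos).
have xe : x < x + e / 2 by rewrite ltrDl divr_gt0.
have [c [xc ce fE]] := MVT_ex xe fdf.
have cx : x - e < c by apply: lt_trans xc; rewrite ltrBlDr ltrDl.
have ce' : c < x + e by apply: (lt_trans ce); rewrite ltrD2l; lra.
have [_ gc0] := h c cx ce'.
have dfc : 0 < df c.
  by have := gE c; rewrite dfx0 subr0 => ->; rewrite mulr_gt0// subr_gt0.
have [] := h (x + e / 2).
- by apply: lt_trans xe; rewrite ltrBlDr ltrDl.
- by rewrite ltrD2l; lra.
move=> + _; rewrite leNgt => /negP; apply.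
by rewrite -subr_gt0 fE mulr_gt0// subr_gt0.
Unshelve. all: by end_near. Qed.

End local_maximum.

Section gluing.
Context {R : realType}.
Implicit Types (f g h df dg dh : R -> R) (c x : R).

Definition glue c f g x : R := if x <= c then f x else g x.

(** This form without case distinction reduces continuity of the gluing to that of min and max. *)
Lemma glueE c f g x : f c = g c ->
  glue c f g x = f (Num.min x c) + g (Num.max x c) - f c.
Proof.
move=> fg; rewrite /glue; case: leP => xc; first by rewrite fg addrK.
by rewrite addrAC subrr add0r.
Qed.

Lemma continuous_glue c f g : f c = g c -> continuous f -> continuous g ->
  continuous (glue c f g).
Proof.
move=> fg cf cg x.
rewrite (_ : glue c f g = fun x => f (Num.min x c) + g (Num.max x c) - f c);
  last by apply/funext => y; exact: glueE.
apply: cvgB; last exact: cvg_cst.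
apply: cvgD.
  apply: (@continuous_comp _ _ _ (fun x => Num.min x c) f); last exact: cf.
  by apply: continuous_min; [exact: cvg_id|exact: cvg_cst].
apply: (@continuous_comp _ _ _ (fun x => Num.max x c) g); last exact: cg.
by apply: continuous_max; [exact: cvg_id|exact: cvg_cst].
Qed.

(** At [c] the Caratheodory slopes of the two pieces share the same limit, so gluing them gives a
    slope continuous at [c]; elsewhere the gluing agrees locally with one piece. *)
Lemma is_derive_glue c f g df dg : f c = g c -> df c = dg c ->
  (forall x : R, is_derive x 1 f (df x)) ->
  (forall x : R, is_derive x 1 g (dg x)) ->
  forall x : R, is_derive x 1 (glue c f g) (glue c df dg x).
Proof.
move=> fg dfg fdf gdg x; have [xc|cx|xc] := ltgtP x c.
- rewrite [glue c df dg _]/glue (ltW xc); apply: near_eq_is_derive (fdf x).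
  near=> y; rewrite /glue ifT// ltW//; near: y; exact: lt_nbhsl.
- rewrite [glue c df dg _]/glue leNgt cx/=; apply: near_eq_is_derive (gdg x).
  near=> y; rewrite /glue leNgt ifF//; apply/negbF.
  by near: y; exact: lt_nbhsr.
- rewrite xc.
  have [f' [fE cf' f'c]] := (is_derive1_caratheodory _ _ _).1 (fdf c).
  have [g' [gE cg' g'c]] := (is_derive1_caratheodory _ _ _).1 (gdg c).
  apply/is_derive1_caratheodory.
  exists (fun y => if y <= c then f' y else g' y).
  split; last by rewrite [glue c df dg _]/glue lexx.
    move=> y; rewrite /glue lexx; case: ifP => _; first exact: fE.
    by rewrite fg gE.
  apply/cvgrPdist_lt => e e0; rewrite /= lexx.
  move/cvgrPdist_lt : cf' => /(_ _ e0) nf.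
  move/cvgrPdist_lt : cg' => /(_ _ e0); rewrite g'c -dfg -f'c => ng.
  by near=> y; case: ifP => _; near: y.
Unshelve. all: by end_near. Qed.

(** The large inequality at [c] and the strict one at [- c] follow [P_sigma], which is thereby
    convertible to such a gluing. *)
Definition glue3 c f g h x : R :=
  if x <= c then f x else if x < - c then g x else h x.

Lemma glue3E c f g h : g (- c) = h (- c) ->
  glue3 c f g h = glue c f (glue (- c) g h).
Proof.
move=> gh; apply/funext => x; rewrite /glue3 /glue; case: ifP => // _.
by case: ltgtP => // ->.
Qed.

Lemma is_derive_glue3 c f g h df dg dh : c < 0 -> f c = g c -> df c = dg c ->
  g (- c) = h (- c) -> dg (- c) = dh (- c) ->
  (forall x : R, is_derive x 1 f (df x)) ->
  (forall x : R, is_derive x 1 g (dg x)) ->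
  (forall x : R, is_derive x 1 h (dh x)) ->
  forall x : R, is_derive x 1 (glue3 c f g h) (glue3 c df dg dh x).
Proof.
move=> c0 fg dfg gh dgh fdf gdg hdh x; rewrite !glue3E//.
have cNc : c <= - c by rewrite lerNr (le_trans (ltW c0))// oppr_ge0 ltW.
apply: is_derive_glue => //; [by rewrite /glue cNc|by rewrite /glue cNc|].
exact: is_derive_glue.
Qed.

Lemma continuous_glue3 c f g h : c < 0 -> f c = g c -> g (- c) = h (- c) ->
  continuous f -> continuous g -> continuous h -> continuous (glue3 c f g h).
Proof.
move=> c0 fg gh cf cg ch; rewrite glue3E//.
have cNc : c <= - c by rewrite lerNr (le_trans (ltW c0))// oppr_ge0 ltW.
apply: continuous_glue => //; first by rewrite /glue cNc.
exact: continuous_glue.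
Qed.

End gluing.

(* Keeps failing unification attempts from unfolding the integral. *)
Opaque phi_ moment.

(** * Signs of the derivatives of phi and of its symmetrization *)

Section phi_sign.
Context {R : realType}.
Variable lam : R.
Hypotheses (lam_gt0 : 0 < lam) (lam_lt : lam < 2^-1).

Notation phi := (phi_ lam).
Notation phi1 := (phi_d1 lam).
Notation phi2 := (phi_d2 lam).

(** The Gaussian weight is the integrating factor of f' + x f. For [phi_d2], [psi1] and [psi2] this
    combination is a negative multiple of [phi_d1], [psi] and [psi1] respectively, so each known
    sign yields a monotonicity. *)
Lemma is_derive_gaussM (f df : R -> R) (x : R) :
  (forall x : R, is_derive x 1 f (df x)) ->
  is_derive x 1 (fun x => expR (x ^+ 2 / 2) * f x)
    (expR (x ^+ 2 / 2) * (df x + x * f x)).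
Proof. by move=> fdf; is_derive_auto; field. Qed.

Lemma phi2_lt (x y : R) : x < y -> y <= 0 ->
  expR (y ^+ 2 / 2) * phi2 y < expR (x ^+ 2 / 2) * phi2 x.
Proof.
move=> xy y0.
apply: (derive_lt0_lt xy
  (fun x => is_derive_gaussM x (is_derive_phi2 lam_gt0 lam_lt))) => z _ zy.
rewrite pmulr_rlt0 ?expR_gt0//.
have -> : - (z * phi2 z) - (1 + 2 * lam) * phi1 z + z * phi2 z =
  - ((1 + 2 * lam) * phi1 z) by ring.
rewrite oppr_lt0 mulr_gt0// ?phi1_gt0//; last by rewrite ltW// (lt_le_trans zy).
by rewrite addr_gt0// mulr_gt0.
Qed.

(** Written with moments, the second derivative has only nonnegative terms for x <= -1. This
    confines [x1_] to ]-1, 0[, which the tail estimate exploits. *)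
Lemma phi2_gt0 (x : R) : x <= - 1 -> 0 < phi2 x.
Proof.
move=> x1.
have -> : phi2 x = expR (- (x ^+ 2 / 2)) *
    (moment lam 2 x - 2 * (x * moment lam 1 x) + (x ^+ 2 - 1) * moment lam 0 x).
  by rewrite /phi_d2 /phi_d1 phiE// moment2E//; field.
have m k : 0 < moment lam k x by exact: moment_gt0.
rewrite mulr_gt0 ?expR_gt0//.
have h1 : x * moment lam 1 x <= 0 by rewrite mulr_le0_ge0 ?(ltW (m _))//; lra.
have h2 : 0 <= (x ^+ 2 - 1) * moment lam 0 x.
  by rewrite mulr_ge0 ?(ltW (m _))//; nra.
by have := m 2%N; lra.
Qed.

Lemma phi_d2E (x : R) : phi2 x = - (x * phi1 x) - 2 * lam * phi x.
Proof. by []. Qed.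

(** After the Gaussian factor is pulled out, what is left is a moment, which increases with its
    argument. *)
Lemma phiN_le (x : R) : 0 <= x -> phi (- x) <= expR (- (x ^+ 2 / 2)) * phi 0.
Proof.
move=> x0; rewrite !phiE// sqrrN [0 ^+ 2]expr0n/= mul0r oppr0 expR0 mul1r.
rewrite ler_wpM2l ?expR_ge0//.
apply: (derive_ge0_le _ (fun x => is_derive_moment lam_gt0 lam_lt 0 x)).
  by rewrite oppr_le0.
by move=> z _ _; rewrite ltW// moment_gt0.
Qed.

Opaque phi_d1 phi_d2.

(** The even solution of the same equation; rescaled by [sigma], it is the inner piece of the
    profile. *)
Definition psi (x : R) : R := phi x + phi (- x).
Definition psi1 (x : R) : R := phi1 x - phi1 (- x).
Definition psi2 (x : R) : R := phi2 x + phi2 (- x).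

Lemma is_derive_compN (f df : R -> R) (x : R) :
  (forall x : R, is_derive x 1 f (df x)) ->
  is_derive x 1 (fun x => f (- x)) (- df (- x)).
Proof.
move=> fdf; rewrite -mulrN1.
exact: is_derive_compf (fdf _) (is_derive_oppf (is_derive_idf x)).
Qed.

Lemma is_derive_psi (x : R) : is_derive x 1 psi (psi1 x).
Proof.
have d := is_derive_phi lam_gt0 lam_lt.
exact: is_derive_addf (d x) (is_derive_compN x d).
Qed.

Lemma is_derive_psi1 (x : R) : is_derive x 1 psi1 (psi2 x).
Proof.
have d := is_derive_phi1 lam_gt0 lam_lt.
apply: (is_derive_eq
  (is_derive_addf (d x) (is_derive_oppf (is_derive_compN x d)))).
by rewrite (opprK (phi2 (- x))).
Qed.

Lemma is_derive_psi2 (x : R) :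
  is_derive x 1 psi2 (- (x * psi2 x) - (1 + 2 * lam) * psi1 x).
Proof.
have d := is_derive_phi2 lam_gt0 lam_lt.
apply: (is_derive_eq (is_derive_addf (d x) (is_derive_compN x d))).
rewrite /psi1 /psi2.
generalize (phi1 x) (phi1 (- x)) (phi2 x) (phi2 (- x)) => a b c e; ring.
Qed.

Lemma psi2E (x : R) : psi2 x = - (x * psi1 x) - 2 * lam * psi x.
Proof.
rewrite /psi2 /psi1 /psi (phi_d2E x) (phi_d2E (- x)).
generalize (phi x) (phi (- x)) (phi1 x) (phi1 (- x)) => a b c e; ring.
Qed.

Lemma psi_gt0 (x : R) : 0 < psi x.
Proof. by rewrite addr_gt0 ?phi_gt0. Qed.

Lemma psi1_lt0 (x : R) : 0 < x -> psi1 x < 0.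
Proof.
move=> x0; rewrite -(pmulr_rlt0 _ (expR_gt0 (x ^+ 2 / 2))).
(* [psi1] vanishes at 0 by parity, so strict decrease of the weighted function gives the sign. *)
have -> : 0 = expR (0 ^+ 2 / 2) * psi1 0 :> R.
  by rewrite /psi1 oppr0 subrr mulr0.
apply: (derive_lt0_lt x0 (fun x => is_derive_gaussM x is_derive_psi1)) => z _ _.
rewrite pmulr_rlt0 ?expR_gt0// psi2E.
have -> : - (z * psi1 z) - 2 * lam * psi z + z * psi1 z = - (2 * lam * psi z).
  by ring.
by rewrite oppr_lt0 mulr_gt0 ?psi_gt0// mulr_gt0.
Qed.

(** As [psi1] is negative on the positive axis, the weighted [psi2] increases there up to its value
    0 at z. *)
Lemma psi2_le0 (x z : R) : 0 <= x -> x <= z -> psi2 z = 0 -> psi2 x <= 0.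
Proof.
move=> x0 xz z0; rewrite -(pmulr_rle0 _ (expR_gt0 (x ^+ 2 / 2))).
rewrite -(mulr0 (expR (z ^+ 2 / 2))) -z0.
apply: (derive_ge0_le xz
  (fun x => is_derive_gaussM x is_derive_psi2)) => y xy _.
rewrite mulr_ge0 ?expR_ge0//.
have -> : - (y * psi2 y) - (1 + 2 * lam) * psi1 y + y * psi2 y =
  (1 + 2 * lam) * - psi1 y by ring.
rewrite mulr_ge0//; first by rewrite addr_ge0// mulr_ge0// ltW.
by rewrite oppr_ge0 ltW// psi1_lt0// (le_lt_trans x0).
Qed.

Lemma psi2N (x : R) : psi2 (- x) = psi2 x.
Proof. rewrite /psi2 (opprK x); exact: addrC. Qed.

Lemma psi1N (x : R) : psi1 (- x) = - psi1 x.
Proof. by rewrite /psi1 opprK opprB. Qed.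

Lemma psiN (x : R) : psi (- x) = psi x.
Proof. rewrite /psi (opprK x); exact: addrC. Qed.

End phi_sign.

(** * The roots defining sigma *)

Section roots.
Context {R : realType}.
Variables sigma lam : R.
Hypotheses (sigma_gt0 : 0 < sigma) (lamE : is_lambda sigma lam).

(* [get] returns [0] on an empty predicate, which would force [sigma = 0]. *)
Lemma x1_z_P : [/\ x1_ lam < 0, phi_d2 lam (x1_ lam) = 0, 0 < z_ lam,
  psi2 lam (z_ lam) = 0 & x1_ lam / sigma = - z_ lam].
Proof.
have [lam0 lam2 sE] := lamE.
have [x1_0 x1_root] : x1_ lam < 0 /\ phi_d2 lam (x1_ lam) = 0.
  have [x1|/forallNP x1N] := pselect (exists x : R,
      x < 0 /\ derive1n 2 (phi_ lam) x = 0).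
    by have := getPex x1; rewrite phi2E.
  move: sE; rewrite /sigma_ /x1_ getPN// => /esym; rewrite oppr0 mul0r => s0.
  by move: sigma_gt0; rewrite s0 ltxx.
have [z0 z_root] : 0 < z_ lam /\ psi2 lam (z_ lam) = 0.
  have [z|/forallNP zN] := pselect (exists z : R, 0 < z /\
      derive1n 2 (phi_ lam) z + derive1n 2 (phi_ lam) (- z) = 0).
    by have := getPex z; rewrite !phi2E.
  move: sE; rewrite /sigma_ /z_ getPN// => /esym; rewrite invr0 mulr0 => s0.
  by move: sigma_gt0; rewrite s0 ltxx.
split=> //; rewrite -sE /sigma_; field.
by rewrite (lt_eqF x1_0) (gt_eqF z0).
Qed.

End roots.

(** * The profile P *)

(** The sign [s] covers both parities: 1 for [P_sigma] and -1 for its derivative [P_d1]. *)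
Lemma glue3N (R : realType) (s c : R) (f g h : R -> R) (x : R) :
  c < 0 -> f c = g c -> s * s = 1 ->
  (forall x, h x = s * f (- x)) -> (forall x, g (- x) = s * g x) ->
  glue3 c f g h (- x) = s * glue3 c f g h x.
Proof.
move=> c0 fg ss hE gN; rewrite /glue3.
have ssf y : s * (s * f y) = f y by rewrite mulrA ss mul1r.
have [xc|cx|->] := ltgtP x c.
- rewrite ifF; last by apply/negbTE; rewrite -ltNge; lra.
  rewrite ifF; last by apply/negbTE; rewrite -leNgt; lra.
  by rewrite hE opprK.
- have [xNc|Ncx|->] := ltgtP x (- c).
  + rewrite ifF; last by apply/negbTE; rewrite -ltNge; lra.
    by rewrite ifT ?gN//; lra.
  + by rewrite ifT ?hE ?ssf//; lra.
  + by rewrite opprK lexx hE opprK ssf.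
- by rewrite ifF ?ltxx ?hE ?opprK//; apply/negbTE; rewrite -ltNge; lra.
Qed.

Section G_sigma.
Context {R : realType}.
Variable sigma : R.

Lemma G_sigma_ge0 (a : R) : 0 <= a -> G_sigma sigma a = a / 2.
Proof.
move=> a0; rewrite /G_sigma /neg_part /pos_part max_r// max_l ?oppr_le0//.
by rewrite mulr0 subr0 mulrC.
Qed.

Lemma G_sigma_le0 (a : R) : a <= 0 -> G_sigma sigma a = sigma ^+ 2 * a / 2.
Proof.
move=> a0; rewrite /G_sigma /neg_part /pos_part max_l// max_r ?oppr_ge0//.
by rewrite mulrN opprK add0r mulrC.
Qed.

Lemma G_sigmaM (k a : R) : 0 <= k ->
  G_sigma sigma (k * a) = k * G_sigma sigma a.
Proof.
move=> k0; have [a0|a0] := leP 0 a.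
  by rewrite !G_sigma_ge0 ?mulr_ge0// mulrA.
have ka0 : k * a <= 0 by rewrite mulr_ge0_le0// ltW.
by rewrite (G_sigma_le0 ka0) (G_sigma_le0 (ltW a0)); ring.
Qed.

Lemma G_sigma_mono (a b : R) : a <= b -> G_sigma sigma a <= G_sigma sigma b.
Proof.
move=> ab; have [a0|a0] := leP 0 a.
  by rewrite !G_sigma_ge0 ?(le_trans a0)//; lra.
have [b0|b0] := leP 0 b.
  rewrite G_sigma_le0 ?(ltW a0)// G_sigma_ge0//.
  have : sigma ^+ 2 * a <= 0 by rewrite mulr_ge0_le0 ?sqr_ge0 ?ltW.
  by lra.
rewrite !G_sigma_le0 ?(ltW a0) ?(ltW b0)//.
have : sigma ^+ 2 * a <= sigma ^+ 2 * b by rewrite ler_wpM2l ?sqr_ge0.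
by lra.
Qed.

(** The slopes of G are 1/2 and sigma^2 / 2, both at most 1/2. This controls the penalty term in the
    comparison argument. *)
Lemma G_sigmaB_ge (a b : R) : 0 <= sigma -> sigma <= 1 -> 0 <= b ->
  G_sigma sigma a - b / 2 <= G_sigma sigma (a - b).
Proof.
move=> s0 s1 b0.
have s2 : sigma ^+ 2 <= 1 by rewrite exprn_ile1.
have s20 := sqr_ge0 sigma.
have [a0|a0] := leP 0 a.
  rewrite (G_sigma_ge0 a0); have [ab|ab] := leP 0 (a - b).
    by rewrite G_sigma_ge0//; lra.
  rewrite G_sigma_le0 ?(ltW ab)//.
  have : (a - b) * 1 <= (a - b) * sigma ^+ 2.
    by apply: ler_wnM2l => //; exact: ltW.
  by lra.
rewrite !G_sigma_le0 ?(ltW a0)//; last by lra.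
have : b * sigma ^+ 2 <= b * 1 by rewrite ler_wpM2l.
by lra.
Qed.

End G_sigma.

Section P_sigma.
Context {R : realType}.
Variables sigma lam : R.
Hypotheses (sigma_gt0 : 0 < sigma) (lamE : is_lambda sigma lam).

Notation x1 := (x1_ lam).
Notation m := (mu1 sigma lam).
Notation P := (P_sigma sigma lam).

Let lam_gt0 : 0 < lam. Proof. by case: lamE. Qed.
Let lam_lt : lam < 2^-1. Proof. by case: lamE. Qed.
Let x1_lt0 : x1 < 0. Proof. by case: (x1_z_P sigma_gt0 lamE). Qed.
Let x1_root : phi_d2 lam x1 = 0. Proof. by case: (x1_z_P sigma_gt0 lamE). Qed.
Let z_root : psi2 lam (z_ lam) = 0.
Proof. by case: (x1_z_P sigma_gt0 lamE). Qed.
Let x1z : x1 / sigma = - z_ lam. Proof. by case: (x1_z_P sigma_gt0 lamE). Qed.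

Definition P_d1 : R -> R := glue3 x1 (fun x => m * phi_d1 lam x)
  (fun x => psi1 lam (x / sigma) / sigma) (fun x => - (m * phi_d1 lam (- x))).

Definition P_d2 : R -> R := glue3 x1 (fun x => m * phi_d2 lam x)
  (fun x => psi2 lam (x / sigma) / sigma ^+ 2) (fun x => m * phi_d2 lam (- x)).

Lemma mu1_gt0 : 0 < m.
Proof. by rewrite divr_gt0 ?phi_gt0// addr_gt0 ?phi_gt0. Qed.

Lemma P_junction : m * phi_ lam x1 = psi lam (x1 / sigma).
Proof. by rewrite /mu1 divfK// gt_eqF// phi_gt0. Qed.

(* Both pieces have a vanishing second derivative at the junction, so that
   their equations determine the same first derivative there. *)
Lemma P_d1_junction : m * phi_d1 lam x1 = psi1 lam (x1 / sigma) / sigma.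
Proof.
have x1_neq0 : x1 != 0 by rewrite lt_eqF.
have s0 : sigma != 0 by rewrite gt_eqF.
apply: (mulfI x1_neq0); have := x1_root; rewrite phi_d2E => r1.
have := z_root; rewrite -psi2N -x1z psi2E => r2.
have -> : x1 * (m * phi_d1 lam x1) = - (2 * lam * (m * phi_ lam x1)).
  have -> : x1 * (m * phi_d1 lam x1) = m * (x1 * phi_d1 lam x1) by ring.
  by rewrite (_ : x1 * _ = - (2 * lam * phi_ lam x1)); [ring|lra].
rewrite P_junction.
have -> : x1 * (psi1 lam (x1 / sigma) / sigma) =
    x1 / sigma * psi1 lam (x1 / sigma) by field.
by lra.
Qed.

Lemma P_d2_junction : m * phi_d2 lam x1 = psi2 lam (x1 / sigma) / sigma ^+ 2.
Proof. by rewrite x1_root x1z psi2N z_root mulr0 mul0r. Qed.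

Lemma is_derive_divs (f df : R -> R) (x : R) :
  (forall x : R, is_derive x 1 f (df x)) ->
  is_derive x 1 (fun x => f (x / sigma)) (df (x / sigma) / sigma).
Proof.
move=> fdf; apply: is_derive_compf (fdf _) _.
apply: (is_derive_eq
  (is_derive_mulf (is_derive_idf x) (is_derive_cstf sigma^-1 x))).
by rewrite mul1r mulr0 addr0.
Qed.

Lemma P_glue3 : P = glue3 x1 (fun x => m * phi_ lam x)
  (fun x => psi lam (x / sigma)) (fun x => m * phi_ lam (- x)).
Proof. by []. Qed.

Opaque x1_ z_ psi psi1 psi2.

Lemma is_derive_P (x : R) : is_derive x 1 P (P_d1 x).
Proof.
rewrite P_glue3.
have d := is_derive_phi lam_gt0 lam_lt.
have df (y : R) : is_derive y 1 (fun x => m * phi_ lam x) (m * phi_d1 lam y).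
  apply: (is_derive_eq (is_derive_mulf (is_derive_cstf m y) (d y))).
  by rewrite mul0r add0r.
have dg (y : R) : is_derive y 1 (fun x => psi lam (x / sigma))
    (psi1 lam (y / sigma) / sigma).
  by apply: is_derive_divs => z; exact: is_derive_psi.
have dh (y : R) : is_derive y 1 (fun x => m * phi_ lam (- x))
    (- (m * phi_d1 lam (- y))).
  have dN := is_derive_compN y d.
  apply: (is_derive_eq (is_derive_mulf (is_derive_cstf m y) dN)).
  by rewrite mul0r add0r mulrN.
apply: (is_derive_glue3 x1_lt0 P_junction P_d1_junction _ _ df dg dh).
- by rewrite mulNr psiN opprK; exact: esym P_junction.
- by rewrite mulNr psi1N opprK mulNr -P_d1_junction.
Qed.

Lemma is_derive_P_d1 (x : R) : is_derive x 1 P_d1 (P_d2 x).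
Proof.
have d := is_derive_phi1 lam_gt0 lam_lt.
have df (y : R) : is_derive y 1 (fun x => m * phi_d1 lam x) (m * phi_d2 lam y).
  apply: (is_derive_eq (is_derive_mulf (is_derive_cstf m y) (d y))).
  by rewrite mul0r add0r.
have dg (y : R) : is_derive y 1 (fun x => psi1 lam (x / sigma) / sigma)
    (psi2 lam (y / sigma) / sigma ^+ 2).
  have dd := is_derive_divs y (is_derive_psi1 lam_gt0 lam_lt).
  apply: (is_derive_eq (is_derive_mulf dd (is_derive_cstf sigma^-1 y))).
  by rewrite mulr0 addr0 expr2 invfM mulrA.
have dh (y : R) : is_derive y 1 (fun x => - (m * phi_d1 lam (- x)))
    (m * phi_d2 lam (- y)).
  have dN := is_derive_compN y d.
  apply: (is_derive_eq (is_derive_oppf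
    (is_derive_mulf (is_derive_cstf m y) dN))).
  by rewrite mul0r add0r mulrN opprK.
apply: (is_derive_glue3 x1_lt0 P_d1_junction P_d2_junction _ _ df dg dh).
- by rewrite mulNr psi1N opprK mulNr -P_d1_junction.
- by rewrite mulNr psi2N opprK; exact: esym P_d2_junction.
Qed.

Lemma continuous_P_d2 : continuous P_d2.
Proof.
have cphi2 : continuous (phi_d2 lam).
  by move=> y; exact: is_derive_continuous (is_derive_phi2 lam_gt0 lam_lt y).
apply: (continuous_glue3 x1_lt0 P_d2_junction).
- by rewrite mulNr psi2N opprK; exact: esym P_d2_junction.
- by move=> y; apply: cvgM; [exact: cvg_cst|exact: cphi2].
- move=> y; have dd := is_derive_divs y (is_derive_psi2 lam_gt0 lam_lt).
  by apply: cvgM; [exact: is_derive_continuous dd|exact: cvg_cst].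
- move=> y; apply: cvgM; first exact: cvg_cst.
  apply: (@continuous_comp _ _ _ (fun y : R => - y) (phi_d2 lam)).
    exact: opp_continuous.
  exact: cphi2.
Qed.

Lemma phi_d2_ge0 (x : R) : x <= x1 -> 0 <= phi_d2 lam x.
Proof.
rewrite le_eqVlt => /predU1P[->|xx1]; first by rewrite x1_root.
have := phi2_lt lam_gt0 lam_lt xx1 (ltW x1_lt0).
by rewrite x1_root mulr0 pmulr_rgt0 ?expR_gt0// => /ltW.
Qed.

(** Division by [sigma] sends the junctions to -z and z, the zeros of [psi2]; the negative half
    follows by parity. *)
Lemma psi2_mid_le0 (x : R) : x1 <= x -> x <= - x1 -> psi2 lam (x / sigma) <= 0.
Proof.
move=> x1x xx1.
have zx : - z_ lam <= x / sigma by rewrite -x1z ler_pM2r ?invr_gt0.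
have xz : x / sigma <= z_ lam.
  by rewrite -[z_ lam]opprK -x1z -mulNr ler_pM2r ?invr_gt0.
have [x0|x0] := leP 0 (x / sigma).
  exact: (psi2_le0 lam_gt0 lam_lt x0 xz).
by rewrite -psi2N (psi2_le0 lam_gt0 lam_lt _ _ z_root)//; lra.
Qed.

Lemma P_d2_ge0 (x : R) : x <= x1 \/ - x1 <= x -> 0 <= P_d2 x.
Proof.
rewrite /P_d2 /glue3; case: ifP => [xx1 _|/negbT].
  by rewrite mulr_ge0 ?phi_d2_ge0// ltW ?mu1_gt0.
rewrite -ltNge => x1x [//|xx1].
rewrite [x < - x1]ltNge xx1/= mulr_ge0 ?phi_d2_ge0//.
  by rewrite ltW ?mu1_gt0.
by rewrite lerNl.
Qed.

Lemma P_d2_le0 (x : R) : x1 <= x -> x <= - x1 -> P_d2 x <= 0.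
Proof.
rewrite le_eqVlt => /predU1P[<-|x1x].
  by rewrite /P_d2 /glue3 lexx x1_root mulr0.
rewrite le_eqVlt => /predU1P[->|xx1].
  rewrite /P_d2 /glue3 ltxx opprK x1_root mulr0.
  by case: ifP => //; rewrite leNgt; move: x1_lt0; lra.
rewrite /P_d2 /glue3 [x <= x1]leNgt x1x/= xx1.
by rewrite mulr_le0_ge0 ?invr_ge0 ?sqr_ge0// psi2_mid_le0// ltW.
Qed.

(** On the outer pieces 2 G(a) = a and this is the equation of [phi_]. On the inner piece 2 G(a) =
    sigma^2 a, and sigma^2 cancels the 1 / sigma^2 produced by the argument x / sigma. *)
Lemma P_ode (x : R) :
  2 * G_sigma sigma (P_d2 x) = - (x * P_d1 x) - 2 * lam * P x.
Proof.
have s0 : sigma != 0 by rewrite gt_eqF.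
have [xx1|x1x] := leP x x1.
  rewrite G_sigma_ge0; last by apply: P_d2_ge0; left.
  by rewrite /P_d2 /P_d1 /P_sigma /glue3 xx1 phi_d2E; field.
have [xx1|xx1] := ltP x (- x1).
  rewrite G_sigma_le0; last by apply: P_d2_le0; exact: ltW.
  rewrite /P_d2 /P_d1 P_glue3 /glue3 [x <= x1]leNgt x1x/= xx1 psi2E.
  by field.
rewrite G_sigma_ge0; last by apply: P_d2_ge0; right.
rewrite /P_d2 /P_d1 /P_sigma /glue3 [x <= x1]leNgt x1x/=.
by rewrite [x < - x1]ltNge xx1/= phi_d2E; field.
Qed.

Lemma P_gt0 (x : R) : 0 < P x.
Proof.
have p0 y := phi_gt0 lam_gt0 lam_lt y.
rewrite /P_sigma; case: ifP => _; first by rewrite mulr_gt0 ?mu1_gt0.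
by case: ifP => _; [rewrite addr_gt0|rewrite mulr_gt0 ?mu1_gt0].
Qed.

Lemma PN (x : R) : P (- x) = P x.
Proof.
rewrite -[RHS]mul1r P_glue3; apply: (glue3N _ x1_lt0 P_junction (mulr1 1)).
- by move=> y; rewrite mul1r.
- by move=> y; rewrite mul1r mulNr psiN.
Qed.

Lemma P_d1N (x : R) : P_d1 (- x) = - P_d1 x.
Proof.
have NN : -1 * -1 = 1 :> R by rewrite mulrNN mul1r.
rewrite -[RHS]mulN1r; apply: (glue3N _ x1_lt0 P_d1_junction NN).
- by move=> y; rewrite mulN1r.
- by move=> y; rewrite mulN1r mulNr psi1N mulNr.
Qed.

Lemma P_d1_le0 (x : R) : 0 <= x -> P_d1 x <= 0.
Proof.
rewrite le_eqVlt => /predU1P[<-|x0].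
  by have := P_d1N 0; rewrite oppr0; lra.
rewrite /P_d1 /glue3 [x <= x1]leNgt (lt_trans x1_lt0 x0)/=; case: ifPn => [_|].
  rewrite mulr_le0_ge0 ?invr_ge0 ?(ltW sigma_gt0)// ltW//.
  by rewrite psi1_lt0// divr_gt0.
move=> _; rewrite oppr_le0 mulr_ge0 ?(ltW mu1_gt0)// ltW// phi1_gt0//.
by rewrite oppr_le0 ltW.
Qed.

Lemma P_0E : P 0 = 2 * phi_ lam 0.
Proof.
rewrite /P_sigma [0 <= x1]leNgt x1_lt0/= oppr_gt0 x1_lt0 !mul0r oppr0.
by rewrite mulr_natl mulr2n.
Qed.

Lemma P_outerE (x : R) : - x1 <= x -> P x = m * phi_ lam (- x).
Proof.
move=> xx1; rewrite /P_sigma [x <= x1]leNgt [x < - x1]ltNge xx1/=.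
by rewrite (lt_le_trans _ xx1)// (lt_trans x1_lt0)// oppr_gt0.
Qed.

Opaque P_sigma P_d1 P_d2.

Lemma P_nincr (x y : R) : 0 <= x -> x <= y -> P y <= P x.
Proof.
move=> x0 xy; apply: (derive_le0_le xy is_derive_P) => z xz _.
by apply: P_d1_le0; apply: le_trans x0 (ltW xz).
Qed.

Lemma P_abs (x : R) : P x = P `|x|.
Proof. by case: (ger0P x) => _; rewrite ?PN. Qed.

Lemma P_le (x : R) : P x <= P 0.
Proof. by rewrite P_abs; exact: P_nincr. Qed.

(** On the positive axis [P_d1] is nonpositive, decreases up to the inflection point [- x1] and
    increases afterwards, so the profile is steepest there. This provides the Lipschitz constant of
    the datum. *)
Lemma P_d1_bounded (x : R) : `|P_d1 x| <= - P_d1 (- x1).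
Proof.
wlog x0 : x / 0 <= x.
  move=> h; have [/h//|x0] := leP 0 x.
  by have := h (- x); rewrite (P_d1N x) normrN; apply; rewrite oppr_ge0 ltW.
rewrite (ler0_norm (P_d1_le0 x0)) lerN2; have [xx1|xx1] := leP x (- x1).
  apply: (derive_le0_le xx1 is_derive_P_d1) => y xy yx1.
  apply: P_d2_le0; last exact: ltW.
  by move: x1_lt0; lra.
apply: (derive_ge0_le (ltW xx1) is_derive_P_d1) => y x1y _.
by apply: P_d2_ge0; right; exact: ltW.
Qed.

Lemma x1_gtN1 : - 1 < x1.
Proof.
rewrite ltNge; apply/negP => /(phi2_gt0 lam_gt0 lam_lt).
by rewrite x1_root ltxx.
Qed.

(** The two entries of the maximum belong to the two regions. Inside, x < - x1 < 1 gives exp(-x^2/2)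
    >= 1/2, so 2 suffices; outside, [phiN_le] and P 0 = 2 phi 0 give m / 2. *)
Lemma P_tail (x : R) : 0 <= x ->
  P x <= Num.max 2 (m / 2) * expR (- (x ^+ 2 / 2)) * P 0.
Proof.
move=> x0; have e0 := expR_gt0 (- (x ^+ 2 / 2)).
have [xx1|xx1] := ltP x (- x1).
  apply: (le_trans (P_le x)); rewrite -[leLHS]mul1r.
  apply: ler_wpM2r; first exact: ltW (P_gt0 _).
  apply: (@le_trans _ _ (2 * expR (- (x ^+ 2 / 2)))).
    have := expR_ge1Dx (- (x ^+ 2 / 2)); have := x1_gtN1.
    have : x * x <= 1 * 1 by have := x1_gtN1 => ?; apply: ler_pM => //; lra.
    by rewrite -expr2; lra.
  by rewrite ler_pM2r// le_max lexx.
apply: (@le_trans _ _ (m / 2 * expR (- (x ^+ 2 / 2)) * P 0)).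
  rewrite (P_outerE xx1) P_0E.
  have -> : m / 2 * expR (- (x ^+ 2 / 2)) * (2 * phi_ lam 0) =
    m * (expR (- (x ^+ 2 / 2)) * phi_ lam 0) by field.
  by rewrite ler_wpM2l ?phiN_le// ltW ?mu1_gt0.
by rewrite ler_pM2r ?P_gt0// ler_pM2r// le_max lexx orbT.
Qed.

End P_sigma.

(** * Smooth functions and viscosity solutions *)

Section prod_nbhs.
Context {R : realType}.
Implicit Types (t x : R) (Q : R * R -> Prop).

Lemma near_pair_fst Q t x : (\forall p \near (t, x), Q p) ->
  \forall s \near t, Q (s, x).
Proof.
move=> [[A B] /= [nA nB] AB]; apply: filterS nA => s As.
by apply: AB; split => //=; exact: nbhs_singleton nB.
Qed.

Lemma near_pair_snd Q t x : (\forall p \near (t, x), Q p) ->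
  \forall y \near x, Q (t, y).
Proof.
move=> [[A B] /= [nA nB] AB]; apply: filterS nB => y By.
by apply: AB; split => //=; exact: nbhs_singleton nA.
Qed.

Lemma near_fst_gt0 t x : 0 < t -> \forall p \near (t, x), 0 < p.1.
Proof.
move=> t0; exists ([set s | 0 < s], setT) => /=; last by move=> p [].
by split; [exact: lt_nbhsr|exact: filterT].
Qed.

Lemma continuous_at_fst t x : {for (t, x), continuous (fun p : R * R => p.1)}.
Proof. exact: cvg_fst. Qed.

Lemma continuous_at_snd t x : {for (t, x), continuous (fun p : R * R => p.2)}.
Proof. exact: cvg_snd. Qed.

Lemma continuous_at_near_eq (f g : R * R -> R) (t x : R) : 0 < t ->
  (forall s y, 0 < s -> f (s, y) = g (s, y)) ->
  {for (t, x), continuous f} -> {for (t, x), continuous g}.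
Proof.
move=> t0 fg cf; rewrite /prop_for /continuous_at -(fg _ _ t0).
apply: cvg_trans cf; apply: near_eq_cvg.
by apply: filterS (near_fst_gt0 x t0) => -[s y] /= s0; rewrite fg.
Qed.

End prod_nbhs.

Section smooth_functions.
Context {R : realType}.
Implicit Types (w wt wx wxx psi : R -> R -> R).

Lemma C12_of_derivatives w wt wx wxx :
  (forall t x : R, 0 < t -> is_derive t 1 (w ^~ x) (wt t x)) ->
  (forall t x : R, 0 < t -> is_derive x 1 (w t) (wx t x)) ->
  (forall t x : R, 0 < t -> is_derive x 1 (wx t) (wxx t x)) ->
  (forall t x : R, 0 < t ->
    [/\ {for (t, x), continuous (fun p : R * R => w p.1 p.2)},
        {for (t, x), continuous (fun p : R * R => wt p.1 p.2)},
        {for (t, x), continuous (fun p : R * R => wx p.1 p.2)}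
      & {for (t, x), continuous (fun p : R * R => wxx p.1 p.2)}]) ->
  [/\ C12 w, forall t x, 0 < t -> d_t w t x = wt t x
    & forall t x, 0 < t -> d_xx w t x = wxx t x].
Proof.
move=> dt dx dxx cw.
have dtE t x : 0 < t -> d_t w t x = wt t x.
  by move=> t0; exact: is_derive_derive1 (dt t x t0).
have dxE t : 0 < t -> derive1 (w t) = wx t.
  by move=> t0; apply/funext => x; exact: is_derive_derive1 (dx t x t0).
have dxxE t x : 0 < t -> d_xx w t x = wxx t x.
  move=> t0; rewrite /d_xx /derive1n/= (dxE _ t0).
  exact: is_derive_derive1 (dxx t x t0).
split => // t x t0; have [c0 c1 c2 c3] := cw t x t0; split; split.
- exact: is_derive_derivable (dt t x t0).
- exact: is_derive_derivable (dx t x t0).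
- by rewrite dxE//; exact: is_derive_derivable (dxx t x t0).
- exact: c0.
- by apply: continuous_at_near_eq c1 => // s y s0; rewrite dtE.
- by apply: continuous_at_near_eq c2 => // s y s0; rewrite dxE.
- by apply: continuous_at_near_eq c3 => // s y s0; rewrite dxxE.
Qed.

Lemma C12_derive psi (t x : R) : C12 psi -> 0 < t ->
  [/\ is_derive t 1 (psi ^~ x) (d_t psi t x),
      is_derive x 1 (psi t) (derive1 (psi t) x)
    & is_derive x 1 (derive1 (psi t)) (d_xx psi t x)].
Proof.
move=> Cpsi t0; have [[h1 h2 h3] _] := Cpsi t x t0.
have dd (f : R -> R) (y : R) : derivable f y 1 -> is_derive y 1 f (derive1 f y).
  by move=> df; apply: DeriveDef => //; rewrite derive1E.
split; [exact: dd h1|exact: dd h2|exact: (dd _ _ h3)].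
Qed.

Lemma local_max_derivatives (f g : R -> R -> R) (ft gt fx gx : R -> R)
    (fxx gxx t x : R) :
  (\forall s \near t, is_derive (s : R) 1 (f ^~ x) (ft s)) ->
  (\forall s \near t, is_derive (s : R) 1 (g ^~ x) (gt s)) ->
  (forall y : R, is_derive y 1 (f t) (fx y)) ->
  (forall y : R, is_derive y 1 (g t) (gx y)) ->
  is_derive x 1 fx fxx -> is_derive x 1 gx gxx ->
  (\forall p \near (t, x), f p.1 p.2 - g p.1 p.2 <= f t x - g t x) ->
  ft t = gt t /\ fxx <= gxx.
Proof.
move=> dft dgt dfx dgx dfxx dgxx fg; split.
  apply/eqP; rewrite -subr_eq0; apply/eqP.
  have nd : \forall s \near t, derivable (fun s => f s x - g s x) (s : R) 1.
    apply: filterS2 dft dgt => s fs gs.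
    exact: is_derive_derivable (is_derive_addf fs (is_derive_oppf gs)).
  have dft0 := nbhs_singleton dft; have dgt0 := nbhs_singleton dgt.
  apply: (local_max_derive nd (is_derive_addf dft0 (is_derive_oppf dgt0))).
  exact: near_pair_fst fg.
rewrite -subr_le0.
have dfgx (y : R) := is_derive_addf (dfx y) (is_derive_oppf (dgx y)).
have dfgxx := is_derive_addf dfxx (is_derive_oppf dgxx).
exact: local_max_derive2 dfgx dfgxx (near_pair_snd fg).
Qed.

Section classical_solutions.
Variables (sigma : R) (u ut ux uxx : R -> R -> R).
Hypothesis dut : forall t x : R, 0 < t -> is_derive t 1 (u ^~ x) (ut t x).
Hypothesis dux : forall t x : R, 0 < t -> is_derive x 1 (u t) (ux t x).
Hypothesis duxx : forall t x : R, 0 < t -> is_derive x 1 (ux t) (uxx t x).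
Hypothesis u_eq : forall t x : R, 0 < t -> ut t x = G_sigma sigma (uxx t x).

(** At a maximum of u - psi the time derivatives agree and the second space derivatives are ordered;
    monotonicity of G transfers the equation to psi. *)
Lemma classical_visc_subsol : visc_subsol sigma u.
Proof.
move=> psi t x Cpsi t0 umax.
have [_ _ pxx] := C12_derive x Cpsi t0.
have [] := @local_max_derivatives u psi (ut ^~ x) ((d_t psi) ^~ x) (ux t)
  (derive1 (psi t)) (uxx t x) (d_xx psi t x) t x _ _ _ _ (duxx x t0) pxx umax.
- by near=> s; apply: dut; near: s; exact: lt_nbhsr.
- near=> s; have s0 : 0 < s by near: s; exact: lt_nbhsr.
  by have [] := C12_derive x Cpsi s0.
- by move=> y; exact: dux.
- by move=> y; have [] := C12_derive y Cpsi t0.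
by move=> <- uxx_le; rewrite subr_le0 u_eq// G_sigma_mono.
Unshelve. all: by end_near. Qed.

Lemma classical_visc_supersol : visc_supersol sigma u.
Proof.
move=> psi t x Cpsi t0 umin.
have [_ _ pxx] := C12_derive x Cpsi t0.
have umax : \forall p \near (t, x),
    psi p.1 p.2 - u p.1 p.2 <= psi t x - u t x.
  by apply: filterS umin => p; lra.
have [] := @local_max_derivatives psi u ((d_t psi) ^~ x) (ut ^~ x)
  (derive1 (psi t)) (ux t) (d_xx psi t x) (uxx t x) t x _ _ _ _ pxx (duxx x t0)
  umax.
- near=> s; have s0 : 0 < s by near: s; exact: lt_nbhsr.
  by have [] := C12_derive x Cpsi s0.
- by near=> s; apply: dut; near: s; exact: lt_nbhsr.
- by move=> y; have [] := C12_derive y Cpsi t0.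
- by move=> y; exact: dux.
by move=> -> uxx_le; rewrite subr_ge0 u_eq// G_sigma_mono.
Unshelve. all: by end_near. Qed.

End classical_solutions.

Lemma bounded_half_plane (u : R -> R -> R) :
  [bounded u p.1 p.2 | p in [set p : R * R | 0 <= p.1]] ->
  exists M, forall t x, 0 <= t -> `|u t x| <= M.
Proof.
move=> /pinfty_ex_gt0[M M0 uM]; exists M => t x t0.
exact: (uM (t, x)).
Qed.

Lemma half_plane_bounded (u : R -> R -> R) (M : R) :
  (forall t x, 0 <= t -> `|u t x| <= M) ->
  [bounded u p.1 p.2 | p in [set p : R * R | 0 <= p.1]].
Proof.
move=> uM; rewrite /bounded_near; near=> N => -[t x] /= t0.
apply: (le_trans (uM t x t0)).
by near: N; apply: nbhs_pinfty_ge; exact: num_real.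
Unshelve. all: by end_near. Qed.

(* Adding a small multiple of [x ^+ 2 + 2 * t] to [u - w] makes it coercive, so
   that it attains its minimum; a minimum at a positive time would contradict
   the supersolution property. *)
Lemma visc_supersol_ge (sigma : R) (u w : R -> R -> R) (t0 x0 : R) :
  0 <= sigma -> sigma <= 1 -> visc_supersol sigma u ->
  {within [set p : R * R | 0 <= p.1],
     continuous (fun p : R * R => u p.1 p.2)} ->
  {within [set p : R * R | 0 <= p.1],
     continuous (fun p : R * R => w p.1 p.2)} ->
  [bounded u p.1 p.2 | p in [set p : R * R | 0 <= p.1]] ->
  [bounded w p.1 p.2 | p in [set p : R * R | 0 <= p.1]] ->
  C12 w -> (forall t x, 0 < t -> d_t w t x <= G_sigma sigma (d_xx w t x)) ->
  (forall x, w 0 x <= u 0 x) ->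
  0 <= t0 -> w t0 x0 <= u t0 x0.
Proof.
move=> s0 s1 super cu cw /bounded_half_plane[Mu uM] /bounded_half_plane[Mw wM].
move=> Cw wG wu t00; apply/ler_addgt0Pr => e e0.
(* With k = e / D the penalty costs at most e at the given point. *)
pose D := x0 ^+ 2 + 2 * t0 + 1.
have D0 : 0 < D by rewrite /D; have := sqr_ge0 x0; lra.
pose k := e / D; have k0 : 0 < k by rewrite divr_gt0.
pose F (p : R * R) := u p.1 p.2 - w p.1 p.2 + k * (p.2 ^+ 2 + 2 * p.1).
suff F0 : 0 <= F (t0, x0).
  have : k * (x0 ^+ 2 + 2 * t0) <= e.
    rewrite /k mulrAC ler_pdivrMr// ler_wpM2l ?(ltW e0)//.
    by rewrite /D lerDl.
  by move: F0; rewrite /F/=; lra.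
rewrite leNgt; apply/negP => Fneg.
pose B := Mu + Mw + 1.
have B1 : 1 <= B.
  have := le_trans (normr_ge0 _) (uM _ x0 t00).
  by have := le_trans (normr_ge0 _) (wM _ x0 t00); rewrite /B; lra.
(* Outside the box the penalty is at least [B], more than |u - w| can reach. The summand 1 makes L
   >= 1, so that L <= |x| implies L <= x^2; [|x0|] and [t0] keep the given point inside. *)
pose L := B / k + `|x0| + 1; pose T := B / k + t0 + 1.
have Bk0 : 0 < B / k by rewrite divr_gt0//; lra.
have Fpos p : 0 <= p.1 -> T <= p.1 \/ L <= `|p.2| -> 0 < F p.
  case: p => t x /= t_ge0 far.
  have : B <= k * (x ^+ 2 + 2 * t).
    rewrite mulrC -ler_pdivrMr//; case: far => [Tt|Lx].
      by have := sqr_ge0 x; move: Tt; rewrite /T; lra.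
    rewrite -[x ^+ 2]real_normK ?num_real//.
    have : L <= `|x| ^+ 2.
      apply: (le_trans Lx); rewrite -[leLHS]expr1 ler_weXn2l//.
      by apply: le_trans Lx; rewrite /L; have := normr_ge0 x0; lra.
    by rewrite /L; have := normr_ge0 x0; lra.
  have := uM t x t_ge0; have := wM t x t_ge0; rewrite !ler_norml.
  by rewrite /F/= /B => /andP[? ?] /andP[? ?]; lra.
pose K := `[0, T]%classic `*` `[- L, L]%classic : set (R * R).
have K0 : K (t0, x0).
  rewrite /K /=; split; rewrite /= in_itv/=; last rewrite -ler_norml.
    by rewrite t00/= /T; lra.
  by rewrite /L; lra.
have cM2 (s y : R) : {for (s, y), continuous (fun p : R * R => p.2 ^+ 2)}.
  apply: (@continuous_comp _ _ _ (fun p : R * R => p.2) (fun y => y ^+ 2)).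
    exact: continuous_at_snd.
  exact: exprn_continuous.
have cF : {within K, continuous F}.
  apply: (@continuous_subspaceW _ _ _ [set p : R * R | 0 <= p.1]).
    by move=> p [/=]; rewrite in_itv/= => /andP[].
  move=> p; apply: cvgD; first by apply: cvgB; [exact: cu|exact: cw].
  apply: (@continuous_subspaceT _ _ _
    (fun p : R * R => k * (p.2 ^+ 2 + 2 * p.1))) => -[t x].
  apply: cvgM; first exact: cvg_cst.
  apply: cvgD; first exact: cM2.
  by apply: cvgM; [exact: cvg_cst|exact: continuous_at_fst].
have cK : compact K by apply: compact_setX; exact: segment_compact.
have K_neq0 : K !=set0 by exists (t0, x0).
have [[t x] /set_mem[/= tT xL] Fmin] := compact_EVT_min K_neq0 cK cF.
move: tT xL; rewrite !in_itv/= => /andP[t_ge0 tT] /andP[Lx xL].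
have Ftx : F (t, x) < 0 by apply: le_lt_trans Fneg; apply: Fmin; exact/mem_set.
have t_gt0 : 0 < t.
  rewrite lt_neqAle t_ge0 andbT; apply/eqP => t_eq0; move: Ftx.
  rewrite -t_eq0 /F/= ltNge => /negP; apply; rewrite mulr0 addr0.
  by rewrite addr_ge0 ?subr_ge0// mulr_ge0 ?sqr_ge0// ltW.
have [wt wx wxx] : [/\
    forall t x : R, 0 < t -> is_derive t 1 (w ^~ x) (d_t w t x),
    forall t x : R, 0 < t -> is_derive x 1 (w t) (derive1 (w t) x)
    & forall t x : R, 0 < t -> is_derive x 1 (derive1 (w t)) (d_xx w t x)].
  by split=> s y s_gt0; have [] := C12_derive y Cw s_gt0.
(* u - psi is [F], so the minimum of [F] is a touching point. Passing from w to psi lowers the time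
   derivative by 2k but G of the second derivative by at most k, which leaves a contradiction of
   size k. *)
pose psi s y := w s y - k * (y ^+ 2 + 2 * s).
have psi_t (s y : R) : 0 < s ->
    is_derive s 1 (psi ^~ y) (d_t w s y - k * 2).
  by move=> s_gt0; have d := wt s y s_gt0; rewrite /psi; is_derive_auto; ring.
have psi_x (s y : R) : 0 < s ->
    is_derive y 1 (psi s) (derive1 (w s) y - k * (2 * y)).
  by move=> s_gt0; have d := wx s y s_gt0; rewrite /psi; is_derive_auto; ring.
have psi_xx (s y : R) : 0 < s -> is_derive y 1
    (fun y => derive1 (w s) y - k * (2 * y)) (d_xx w s y - k * 2).
  by move=> s_gt0; have d := wxx s y s_gt0; is_derive_auto; ring.
have psi_cont (s y : R) : 0 < s ->
    [/\ {for (s, y), continuous (fun p : R * R => psi p.1 p.2)},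
        {for (s, y), continuous (fun p : R * R => d_t w p.1 p.2 - k * 2)},
        {for (s, y), continuous
          (fun p : R * R => derive1 (w p.1) p.2 - k * (2 * p.2))}
      & {for (s, y), continuous (fun p : R * R => d_xx w p.1 p.2 - k * 2)}].
  move=> s_gt0; have [_ [c0 c1 c2 c3]] := Cw s y s_gt0; split.
  - apply: cvgB => //; apply: cvgM; first exact: cvg_cst.
    apply: cvgD; first exact: cM2.
    by apply: cvgM; [exact: cvg_cst|exact: continuous_at_fst].
  - by apply: cvgB; [exact: c1|exact: cvg_cst].
  - apply: cvgB; first exact: c2.
    apply: cvgM; first exact: cvg_cst.
    by apply: cvgM; [exact: cvg_cst|exact: continuous_at_snd].
  - by apply: cvgB; [exact: c3|exact: cvg_cst].
have [Cpsi psit psixx] := C12_of_derivatives psi_t psi_x psi_xx psi_cont.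
have := super psi t x Cpsi t_gt0.
rewrite psit// psixx// => /(_ _) super_tx.
have : 0 <= d_t w t x - k * 2 - G_sigma sigma (d_xx w t x - k * 2).
  apply: super_tx; apply: filterS (near_fst_gt0 x t_gt0) => -[s y] /= s_gt0.
  suff : F (t, x) <= F (s, y) by rewrite /F/= /psi; lra.
  have [sT|Ts] := ltP s T; last first.
    by rewrite ltW// (lt_trans Ftx)// Fpos ?(ltW s_gt0)//=; left.
  have [yL|Ly] := ltP `|y| L; last first.
    by rewrite ltW// (lt_trans Ftx)// Fpos ?(ltW s_gt0)//=; right.
  apply: Fmin; apply/mem_set; split;
    rewrite /= in_itv/= -?ler_norml ?(ltW yL)//.
  by rewrite !ltW.
have := wG t x t_gt0.
have k2 : 0 <= k * 2 by rewrite mulr_ge0// ltW.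
have := @G_sigmaB_ge _ sigma (d_xx w t x) (k * 2) s0 s1 k2.
lra.
Qed.

End smooth_functions.

(** * Self-similar solutions *)

Section self_similar.
Context {R : realType}.
Variables sigma lam : R.
Hypotheses (sigma_gt0 : 0 < sigma) (lamE : is_lambda sigma lam).
Variables a K c : R.
Hypotheses (a_gt0 : 0 < a) (K_ge0 : 0 <= K).

Notation P := (P_sigma sigma lam).
Notation P_d1 := (P_d1 sigma lam).
Notation P_d2 := (P_d2 sigma lam).

Let lam_gt0 : 0 < lam. Proof. by case: lamE. Qed.

(** These are K (t + a)^-lam and (t + a)^(-1/2). The shift a > 0 moves the singular time before 0;
    the constant [c] of [self_similar] leaves the equation unchanged. *)
Definition amplitude (t : R) : R := K * expR (- (lam * ln (t + a))).
Definition dilation (t : R) : R := expR (- (ln (t + a) / 2)).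
Definition self_similar (t x : R) : R := amplitude t * P (x * dilation t) - c.

(** The time derivative is written as the right-hand side of the equation: [P_ode] is used when
    proving that it is the derivative, and the equation is then positive homogeneity of G. *)
Let ss_t (t x : R) : R :=
  amplitude t * dilation t ^+ 2 * G_sigma sigma (P_d2 (x * dilation t)).
Let ss_x (t x : R) : R := amplitude t * dilation t * P_d1 (x * dilation t).
Let ss_xx (t x : R) : R :=
  amplitude t * dilation t ^+ 2 * P_d2 (x * dilation t).

Lemma dilation_sqr (t : R) : 0 < t + a -> dilation t ^+ 2 = (t + a)^-1.
Proof.
move=> ta; rewrite /dilation -expRM_natl mulrN mulrCA divff// mulr1 expRN.
by rewrite lnK.
Qed.

Lemma amplitude_ge0 (t : R) : 0 <= amplitude t.
Proof. by rewrite mulr_ge0// expR_ge0. Qed.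

Lemma amplitude_le (t : R) : 0 <= t -> amplitude t <= amplitude 0.
Proof.
move=> t0; rewrite ler_wpM2l// ler_expR lerN2 ler_wpM2l ?(ltW lam_gt0)//.
by rewrite ler_ln ?posrE ?ltr_wpDl// lerD2r.
Qed.

Let is_derive_ln_shift (t : R) : 0 < t + a ->
  is_derive t 1 (fun t => ln (t + a)) (t + a)^-1.
Proof.
move=> ta; have d1 : is_derive t 1 (fun t => t + a) 1.
  by is_derive_auto; rewrite addr0.
have := @is_derive_compf _ (@ln R) (fun t => t + a) t _ _ (is_derive1_ln ta) d1.
by rewrite mulr1.
Qed.

Let is_derive_ss_t (t x : R) : 0 < t ->
  is_derive t 1 (self_similar ^~ x) (ss_t t x).
Proof.
move=> t0; have ta : 0 < t + a by rewrite addr_gt0.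
have dl := is_derive_ln_shift ta.
have damp : is_derive t 1 amplitude (- (lam * (t + a)^-1) * amplitude t).
  by rewrite /amplitude; is_derive_auto; ring.
have ddil : is_derive t 1 dilation (- ((t + a)^-1 / 2) * dilation t).
  by rewrite /dilation; is_derive_auto; ring.
have dxi : is_derive t 1 (fun t => x * dilation t)
    (x * (- ((t + a)^-1 / 2) * dilation t)).
  by is_derive_auto; ring.
have dP := @is_derive_compf _ P (fun t => x * dilation t) t _ _
  (is_derive_P sigma_gt0 lamE (x * dilation t)) dxi.
rewrite /self_similar; is_derive_auto.
have ode := P_ode sigma_gt0 lamE (x * dilation t).
rewrite /ss_t dilation_sqr// (_ : G_sigma _ _ = (- (x * dilation t *
  P_d1 (x * dilation t)) - 2 * lam * P (x * dilation t)) / 2); last by lra.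
by field; rewrite gt_eqF.
Qed.

Let is_derive_dil (t x : R) :
  is_derive x 1 (fun x => x * dilation t) (dilation t).
Proof. by is_derive_auto; ring. Qed.

Let is_derive_ss_x (t x : R) : is_derive x 1 (self_similar t) (ss_x t x).
Proof.
have dP := @is_derive_compf _ P (fun x => x * dilation t) x _ _
  (is_derive_P sigma_gt0 lamE (x * dilation t)) (is_derive_dil t x).
by rewrite /self_similar; is_derive_auto; rewrite /ss_x; ring.
Qed.

Let is_derive_ss_xx (t x : R) : is_derive x 1 (ss_x t) (ss_xx t x).
Proof.
have dP := @is_derive_compf _ P_d1 (fun x => x * dilation t) x _ _
  (is_derive_P_d1 sigma_gt0 lamE (x * dilation t)) (is_derive_dil t x).
by rewrite /ss_x; is_derive_auto; rewrite /ss_xx; ring.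
Qed.

Let ss_eq (t x : R) : ss_t t x = G_sigma sigma (ss_xx t x).
Proof.
by rewrite /ss_xx G_sigmaM// mulr_ge0 ?amplitude_ge0// sqr_ge0.
Qed.

Let continuous_ln_shift (t x : R) : 0 < t + a ->
  {for (t, x), continuous (fun p : R * R => ln (p.1 + a))}.
Proof.
move=> ta.
apply: (@continuous_comp _ _ _ (fun p : R * R => p.1) (fun t => ln (t + a))).
  exact: continuous_at_fst.
exact: is_derive_continuous (is_derive_ln_shift ta).
Qed.

Let continuous_amplitude (t x : R) : 0 < t + a ->
  {for (t, x), continuous (fun p : R * R => amplitude p.1)}.
Proof.
move=> ta; apply: cvgM; first exact: cvg_cst.
apply: (@continuous_comp _ _ _ (fun p : R * R => - (lam * ln (p.1 + a))) expR).
  apply: cvgN; apply: cvgM; first exact: cvg_cst.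
  exact: continuous_ln_shift.
exact: continuous_expR.
Qed.

Let continuous_dilation (t x : R) : 0 < t + a ->
  {for (t, x), continuous (fun p : R * R => dilation p.1)}.
Proof.
move=> ta.
apply: (@continuous_comp _ _ _ (fun p : R * R => - (ln (p.1 + a) / 2)) expR).
  apply: cvgN; apply: cvgM; last exact: cvg_cst.
  exact: continuous_ln_shift.
exact: continuous_expR.
Qed.

Let continuous_profile (f : R -> R) (t x : R) : continuous f -> 0 < t + a ->
  {for (t, x), continuous (fun p : R * R => f (p.2 * dilation p.1))}.
Proof.
move=> cf ta.
apply: (@continuous_comp _ _ _ (fun p : R * R => p.2 * dilation p.1) f).
  by apply: cvgM; [exact: continuous_at_snd|exact: continuous_dilation].
exact: cf.
Qed.

Let continuous_G : continuous (G_sigma sigma).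
Proof.
move=> x; apply: cvgM; first exact: cvg_cst.
have cpos y : {for y, continuous (@pos_part R)}.
  by apply: continuous_max; [exact: cvg_cst|exact: cvg_id].
apply: cvgB; first exact: cpos.
apply: cvgM; first exact: cvg_cst.
apply: (@continuous_comp _ _ _ (fun x : R => - x) (@pos_part R)).
  exact: opp_continuous.
exact: cpos.
Qed.

Let continuous_ss (t x : R) : 0 < t + a ->
  [/\ {for (t, x), continuous (fun p : R * R => self_similar p.1 p.2)},
      {for (t, x), continuous (fun p : R * R => ss_t p.1 p.2)},
      {for (t, x), continuous (fun p : R * R => ss_x p.1 p.2)}
    & {for (t, x), continuous (fun p : R * R => ss_xx p.1 p.2)}].
Proof.
move=> ta; have cA := @continuous_amplitude t x ta.
have cD := @continuous_dilation t x ta.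
have cAD2 : {for (t, x), continuous
    (fun p : R * R => amplitude p.1 * dilation p.1 ^+ 2)}.
  by apply: cvgM => //; under eq_fun do rewrite expr2; exact: cvgM.
have cP : continuous P.
  by move=> y; exact: is_derive_continuous (is_derive_P sigma_gt0 lamE y).
have cP1 : continuous P_d1.
  by move=> y; exact: is_derive_continuous (is_derive_P_d1 sigma_gt0 lamE y).
have cP2 : continuous P_d2 by exact: continuous_P_d2.
have cGP2 : continuous (G_sigma sigma \o P_d2).
  by move=> y; apply: continuous_comp; [exact: cP2|exact: continuous_G].
split.
- apply: cvgB; last exact: cvg_cst.
  by apply: cvgM => //; exact: continuous_profile.
- by apply: cvgM => //; exact: (@continuous_profile _ t x cGP2).
- apply: cvgM; first exact: cvgM.
  exact: continuous_profile.
- by apply: cvgM => //; exact: continuous_profile.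
Qed.

Let ss_smooth : [/\ C12 self_similar,
  forall t x, 0 < t -> d_t self_similar t x = ss_t t x
  & forall t x, 0 < t -> d_xx self_similar t x = ss_xx t x].
Proof.
apply: (C12_of_derivatives is_derive_ss_t (fun t x _ => is_derive_ss_x t x)
  (fun t x _ => is_derive_ss_xx t x)) => t x t0.
by apply: continuous_ss; rewrite addr_gt0.
Qed.

Lemma C12_self_similar : C12 self_similar.
Proof. by case: ss_smooth. Qed.

Lemma self_similar_eq (t x : R) : 0 < t ->
  d_t self_similar t x = G_sigma sigma (d_xx self_similar t x).
Proof. by case: ss_smooth => _ dt dxx t0; rewrite dt// dxx// ss_eq. Qed.

Lemma self_similar_sol : G_heat_sol sigma (self_similar 0) self_similar.
Proof.
split => //.
- apply: continuous_in_subspaceT => -[t x]; rewrite inE/= => t0.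
  by have [] := @continuous_ss t x _ => //; rewrite ltr_wpDl.
- apply: (@half_plane_bounded _ _ (amplitude 0 * P 0 + `|c|)) => t x t0.
  have p0 := P_gt0 lamE (x * dilation t).
  apply: (le_trans (ler_normB _ _)); rewrite lerD2r ger0_norm.
    apply: ler_pM; [exact: amplitude_ge0|exact: ltW|exact: amplitude_le|].
    exact: P_le sigma_gt0 lamE _.
  by rewrite mulr_ge0 ?amplitude_ge0// ltW.
- apply: (classical_visc_subsol is_derive_ss_t
    (fun t x _ => is_derive_ss_x t x) (fun t x _ => is_derive_ss_xx t x)).
  by move=> t x _; exact: ss_eq.
- apply: (classical_visc_supersol is_derive_ss_t
    (fun t x _ => is_derive_ss_x t x) (fun t x _ => is_derive_ss_xx t x)).
  by move=> t x _; exact: ss_eq.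
Qed.

Lemma Cb_lip_self_similar : Cb_lip (self_similar 0).
Proof.
split.
  have [_ /bounded_half_plane[M uM] _ _ _] := self_similar_sol.
  rewrite /bounded_near; near=> N => x _ /=.
  apply: (le_trans (uM 0 x (lexx 0))).
  by near: N; apply: nbhs_pinfty_ge; exact: num_real.
pose M := amplitude 0 * dilation 0 * - P_d1 (- x1_ lam).
have ss_xM (x : R) : `|ss_x 0 x| <= M.
  have d0 : 0 <= amplitude 0 * dilation 0.
    by rewrite mulr_ge0 ?amplitude_ge0// expR_ge0.
  rewrite normrM (ger0_norm d0); apply: (ler_wpM2l d0).
  exact: P_d1_bounded sigma_gt0 lamE _.
have lipM := derive_bounded_lipschitz (is_derive_ss_x 0) ss_xM.
rewrite /lipschitz_on; near=> N => -[x y] _ /=; apply: (le_trans (lipM x y)).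
apply: ler_wpM2r; first exact: normr_ge0.
by near: N; apply: nbhs_pinfty_ge; exact: num_real.
Unshelve. all: by end_near. Qed.

End self_similar.

(** * The capacity bounds *)

Lemma divfKM (F : fieldType) (y d e : F) : d != 0 -> d / e / d * y = y / e.
Proof. by move=> d0; rewrite [d / e]mulrC mulfK// mulrC. Qed.

Section capacity_bounds.
Context {R : realType}.
Variables sigma lam eps : R.
Hypotheses (sigma_gt0 : 0 < sigma) (sigma_lt1 : sigma < 1).
Hypothesis lamE : is_lambda sigma lam.
Hypotheses (eps_gt0 : 0 < eps) (eps_lt1 : eps < 1).

Notation P := (P_sigma sigma lam).
Notation E := (eps `^ (2 * lam)).

Let lam_gt0 : 0 < lam. Proof. by case: lamE. Qed.
Let lam_lt : lam < 2^-1. Proof. by case: lamE. Qed.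
Let E_gt0 : 0 < E. Proof. exact: powR_gt0. Qed.
Let eps2_gt0 : 0 < eps ^+ 2. Proof. exact: exprn_gt0. Qed.

Let P_pos (x : R) : 0 < P x. Proof. exact: P_gt0 lamE x. Qed.

Let E_neq0 : E != 0. Proof. by rewrite gt_eqF. Qed.

(** This is (1 + eps^2)^-lam, the value at time 1 of the amplitude with K = 1 and a = eps^2. *)
Let decay : R := expR (- (lam * ln (1 + eps ^+ 2))).

Let decay_le1 : decay <= 1.
Proof.
rewrite expR_le1 oppr_le0 mulr_ge0 ?(ltW lam_gt0)// ln_ge0// lerDl.
exact: ltW.
Qed.

Let decay_ge : 2 `^ (- lam) <= decay.
Proof.
rewrite /powR pnatr_eq0/= ler_expR mulNr lerN2 ler_wpM2l ?(ltW lam_gt0)//.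
rewrite ler_ln ?posrE ?addr_gt0// -[leRHS]/(1 + 1) lerD2l.
by rewrite exprn_ile1// ltW.
Qed.

Let self_similar0E (K c x : R) :
  self_similar sigma lam (eps ^+ 2) K c 0 x = K / E * P (x / eps) - c.
Proof.
have lnE : ln (0 + eps ^+ 2) = ln eps * 2 by rewrite add0r lnXn// mulr_natr.
have dil0 : dilation (eps ^+ 2) 0 = eps^-1.
  by rewrite /dilation lnE mulfK ?pnatr_eq0// expRN lnK ?posrE.
have amp0 : amplitude lam (eps ^+ 2) K 0 = K / E.
  rewrite /amplitude lnE expRN /powR gt_eqF//; congr (K / expR _); ring.
by rewrite /self_similar dil0 amp0.
Qed.

Let self_similar1E (K c : R) :
  self_similar sigma lam (eps ^+ 2) K c 1 0 = K * decay * P 0 - c.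
Proof. by rewrite /self_similar /amplitude mul0r. Qed.

Lemma Gcap_le : (Gcap sigma (- eps) eps <= (P 0 / P 1 * E)%:E)%E.
Proof.
(* [E] cancels the factor eps^(-2 lam) of the initial amplitude, and [P 1] normalizes the datum to 1
   at |x| = eps. *)
pose K := E / P 1.
have K_ge0 : 0 <= K by rewrite divr_ge0 ?ltW.
pose u := self_similar sigma lam (eps ^+ 2) K 0.
apply: ge_ereal_inf; exists (u 1 0)%:E; last first.
  rewrite lee_fin /u self_similar1E subr0.
  have -> : P 0 / P 1 * E = K * 1 * P 0 by rewrite /K; ring.
  by apply: ler_wpM2r; [exact: ltW|exact: ler_wpM2l].
exists (u 0), (u 1 0); split => //.
- exact: Cb_lip_self_similar.
- move=> x; rewrite indicE /u self_similar0E subr0.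
  rewrite (divfKM _ _ E_neq0).
  have [|_] := boolP (x \in _); last by rewrite divr_ge0 ?ltW.
  rewrite inE/= in_itv/= -ler_norml => x_eps.
  rewrite /= ler_pdivlMr// mul1r (P_abs sigma_gt0 lamE (x / eps)).
  apply: (P_nincr sigma_gt0 lamE) => //.
  by rewrite normrM normfV (gtr0_norm eps_gt0) ler_pdivrMr// mul1r.
- by exists u => //; exact: self_similar_sol.
Qed.

Let r_gt0 : 0 < r_ sigma lam.
Proof. by rewrite mulr_gt0// lt_max ltr0n. Qed.

Let rad : R := Num.sqrt (2 * ln (r_ sigma lam * eps `^ (- (2 * lam)))).

(** [rad] solves exp(-rad^2/2) = E / r, and r is 4 times the constant of [P_tail]. *)
Let tail_le : P rad / P 0 <= E / 4.
Proof.
have E_le1 : E <= 1.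
  rewrite /powR gt_eqF// expR_le1 mulr_ge0_le0//; last by rewrite ln_le0// ltW.
  by rewrite mulr_ge0// ltW.
pose m2 := Num.max 2 (mu1 sigma lam / 2).
have m2_ge : 2 <= m2 by rewrite le_max lexx.
have rE : r_ sigma lam = 4 * m2 by [].
(* This makes the logarithm nonnegative; on a negative argument [Num.sqrt] would return 0. *)
have rE_ge1 : 1 <= r_ sigma lam * eps `^ (- (2 * lam)).
  by rewrite powRN ler_pdivlMr// mul1r rE; lra.
have sqr_rad : rad ^+ 2 / 2 = ln (r_ sigma lam * eps `^ (- (2 * lam))).
  by rewrite sqr_sqrtr; [field|rewrite mulr_ge0// ln_ge0].
have := P_tail sigma_gt0 lamE (sqrtr_ge0 _ : 0 <= rad).
rewrite ler_pdivrMr// sqr_rad expRN lnK ?posrE ?(lt_le_trans ltr01)//.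
rewrite -/m2 powRN rE => /le_trans; apply; apply: ler_wpM2r; first exact: ltW.
rewrite le_eqVlt; apply/orP; left; apply/eqP; field.
by rewrite gt_eqF//= gt_eqF// (lt_le_trans _ m2_ge).
Qed.

Lemma Gcap_ge : ((2 `^ (- lam - 1) * E)%:E <=
  Gcap sigma (- (eps * rad)) (eps * rad))%E.
Proof.
apply: le_ereal_inf_tmp => _ [phi [v [_ phi_ge [u [cu bu u0 _ super] ->] ->]]].
rewrite lee_fin.
(* The datum is then at most 1 everywhere, and at most 0 once |x| >= eps * rad, hence below the
   indicator. *)
pose K := E / P 0; pose c := P rad / P 0.
have K_ge0 : 0 <= K by rewrite divr_ge0 ?ltW.
pose w := self_similar sigma lam (eps ^+ 2) K c.
have w0E x : w 0 x = P (x / eps) / P 0 - c.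
  by rewrite /w self_similar0E (divfKM _ _ E_neq0).
have [cw bw _ _ _] : G_heat_sol sigma (w 0) w by exact: self_similar_sol.
have wu : w 1 0 <= u 1 0.
  apply: (@visc_supersol_ge _ sigma u w 1 0 (ltW sigma_gt0) (ltW sigma_lt1)
    super cu cw bu bw); last exact: ler01.
  - exact: (C12_self_similar sigma_gt0 lamE K c eps2_gt0).
  - move=> t x t_gt0.
    by rewrite (self_similar_eq sigma_gt0 lamE _ eps2_gt0 K_ge0 _ t_gt0).
  move=> x; rewrite u0; apply: le_trans (phi_ge x); rewrite w0E indicE.
  have [_|/negP] := boolP (x \in _).
    have Px : P (x / eps) / P 0 <= 1.
      by rewrite ler_pdivrMr// mul1r; exact: P_le sigma_gt0 lamE _.
    have c_ge0 : 0 <= c by rewrite divr_ge0 ?ltW.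
    by rewrite /=; lra.
  rewrite inE/= in_itv/= -ler_norml => /negP; rewrite -ltNge => rad_lt.
  rewrite subr_le0 /c; apply: ler_wpM2r; first by rewrite invr_ge0 ltW.
  rewrite (P_abs sigma_gt0 lamE (x / eps)).
  apply: (P_nincr sigma_gt0 lamE); first exact: sqrtr_ge0.
  rewrite normrM normfV (gtr0_norm eps_gt0) ler_pdivlMr// mulrC.
  exact: ltW.
apply: le_trans wu; rewrite /w self_similar1E.
have -> : K * decay * P 0 = decay * E by rewrite /K; field; rewrite gt_eqF.
have two : 2 `^ (- lam - 1) = 2 `^ (- lam) / 2 :> R.
  by rewrite powRB ?pnatr_eq0 ?implybT// powRr1.
(* It follows that E / 4, which bounds [c], is at most half of 2^-lam * E; the other half is the
   claimed bound. *)
have half : 2^-1 <= 2 `^ (- lam) :> R.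
  rewrite -[leLHS]powR_inv1//; apply: ler_powR; first by rewrite ler1n.
  by have := lam_lt; lra.
have h1 : 2 `^ (- lam) * E <= decay * E by apply: ler_wpM2r; [exact: ltW|].
have h2 : 2^-1 * E <= 2 `^ (- lam) * E by apply: ler_wpM2r; [exact: ltW|].
have := tail_le; rewrite -/c two; lra.
Qed.

End capacity_bounds.

Unset Implicit Arguments.

Theorem theorem4p2 (R : realType) (sigma lam : R)
    (sigma_gt0 : 0 < sigma) (sigma_lt1 : sigma < 1)
    (lamE : is_lambda sigma lam) :
  forall eps : R, 0 < eps -> eps < 1 ->
    (Gcap sigma (- eps) eps
       <= (P_sigma sigma lam 0 / P_sigma sigma lam 1 * eps `^ (2 * lam))%:E)%E /\
    ((2 `^ (- lam - 1) * eps `^ (2 * lam))%:E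
       <= Gcap sigma
            (- (eps * Num.sqrt (2 * ln (r_ sigma lam * eps `^ (- (2 * lam))))))
            (eps * Num.sqrt (2 * ln (r_ sigma lam * eps `^ (- (2 * lam))))))%E.
Proof.
move=> eps eps_gt0 eps_lt1; split; first exact: Gcap_le.
exact: Gcap_ge.
Qed.
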